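(* Let $\Gamma$ be a finite connected simplicial graph of girth at least $6$. If $N$ is the maximum degree of $\Gamma$, then every loxodromic element $g$ of $A(\Gamma)$ permutes cyclically at most $N$ geodesics on $\Gamma^e$; that is, there are an integer $1\le m\le N$ and a collection of $m$ bi-infinite geodesics in $\Gamma^e$ that is preserved and cyclically permuted by $g$.
   Context: For a finite connected simplicial graph $\Gamma$, $A(\Gamma)=\langle v\in V(\Gamma)\mid [u,v]=1 \text{ for all } \{u,v\}\in E(\Gamma)\rangle$ is its right-angled Artin group. For $x,h\in A(\Gamma)$ write $x^h=h^{-1}xh$. The extension graph $\Gamma^e$ is the simplicial graph with vertex set $\{v^g\mid v\in V(\Gamma), g\in A(\Gamma)\}\subset A(\Gamma)$, where two distinct vertices are joined by an edge exactly when they commute in $A(\Gamma)$. It carries the edge metric $d_{\Gamma^e}$. $A(\Gamma)$ acts on $\Gamma^e$ on the right by conjugation, $x\mapsto x^g$. An element $g$ is loxodromic if $\tau(g)=\lim_{n\to\infty} d_{\Gamma^e}(x,x^{g^n})/n>0$ (independent of the vertex $x$). A bi-infinite geodesic is a subgraph that is a bi-infinite path isometrically embedded in $\Gamma^e$. The degree of a vertex is the number of edges incident to it; the maximum degree of a graph is the maximum of the degrees of its vertices. The girth is the minimum length of an embedded cycle (infinite if there are no cycles). *)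

(* Defs.v *)
From HB Require Import structures.
From mathcomp Require Import all_boot all_order all_algebra generic_quotient.
From mathcomp Require Import all_classical all_reals ereal topology normedtype sequences.

Set Implicit Arguments.
Unset Strict Implicit.
Unset Printing Implicit Defensive.

Import Order.TTheory GRing.Theory Num.Theory.
Import numFieldNormedType.Exports.

Local Open Scope classical_set_scope.
Local Open Scope quotient_scope.

Section FiniteGraphs.
Variables (V : finType) (e : rel V).

Definition connected_graph : Prop := forall u v : V, connect e u v.

Definition max_degree : nat := \max_(v : V) #|[set u | e v u]%SET|.

(* [ucycle e c] also holds for c = [::] and, e being symmetric, for
   c = [:: u; v] with {u, v} an edge, hence the bound on the size. *)
Definition embedded_cycle (c : seq V) : Prop := ucycle e c /\ (2 < size c)%N.

Definition girth (R : realType) : \bar R :=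
  ereal_inf [set ((size c)%:R%R)%:E | c in embedded_cycle].

End FiniteGraphs.

Section RAAG.
Variables (V : finType) (e : rel V).

(* (v, true) stands for the letter v and (v, false) for its formal inverse. *)
Definition word := seq (V * bool).

Inductive word_eq : word -> word -> Prop :=
| word_eq_refl w : word_eq w w
| word_eq_sym w1 w2 : word_eq w1 w2 -> word_eq w2 w1
| word_eq_trans w1 w2 w3 : word_eq w1 w2 -> word_eq w2 w3 -> word_eq w1 w3
| word_eq_cat w1 w1' w2 w2' :
    word_eq w1 w1' -> word_eq w2 w2' -> word_eq (w1 ++ w2) (w1' ++ w2')
| word_eq_cancel v b : word_eq [:: (v, b); (v, ~~ b)] [::]
| word_eq_comm u v : e u v ->
    word_eq [:: (u, false); (v, false); (u, true); (v, true)] [::].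

Definition word_eqb : rel word := fun w1 w2 => `[< word_eq w1 w2 >].

Lemma word_eqb_refl : reflexive word_eqb.
Proof. by move=> w; apply/asboolP; exact: word_eq_refl. Qed.

Lemma word_eqb_sym : symmetric word_eqb.
Proof. by move=> w w'; apply/asboolP/asboolP; exact: word_eq_sym. Qed.

Lemma word_eqb_trans : transitive word_eqb.
Proof.
move=> w w1 w2 /asboolP h1 /asboolP h2; apply/asboolP.
exact: word_eq_trans h1 h2.
Qed.

Canonical word_eqb_equiv :=
  EquivRel word_eqb word_eqb_refl word_eqb_sym word_eqb_trans.

Definition raag := {eq_quot word_eqb}.

HB.instance Definition _ := Choice.on raag.

Definition raag_pi (w : word) : raag := \pi_({eq_quot word_eqb}) w.

Definition raag_repr (x : raag) : word := repr (x : {eq_quot word_eqb}).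

Lemma raag_piP w1 w2 : raag_pi w1 = raag_pi w2 <-> word_eq w1 w2.
Proof.
split; first by move=> /eqmodP /asboolP.
by move=> h; apply/eqmodP/asboolP.
Qed.

Lemma raag_reprK x : raag_pi (raag_repr x) = x.
Proof. exact: reprK. Qed.

Definition winv (w : word) : word := rev [seq (a.1, ~~ a.2) | a <- w].

Definition raag_mul (x y : raag) : raag :=
  raag_pi (raag_repr x ++ raag_repr y).
Definition raag_inv (x : raag) : raag := raag_pi (winv (raag_repr x)).
Definition raag_one : raag := raag_pi [::].

Lemma winvK : involutive winv.
Proof.
move=> w; rewrite /winv map_rev revK -map_comp map_id_in // => -[v b] _ /=.
by rewrite negbK.
Qed.

Lemma winv_cat w1 w2 : winv (w1 ++ w2) = winv w2 ++ winv w1.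
Proof. by rewrite /winv map_cat rev_cat. Qed.

Lemma word_eq_mulV w : word_eq (w ++ winv w) [::].
Proof.
elim: w => [|[v b] w IH]; first exact: word_eq_refl.
have -> : ((v, b) :: w) ++ winv ((v, b) :: w)
   = [:: (v, b)] ++ ((w ++ winv w) ++ [:: (v, ~~ b)]).
  by rewrite -cat1s winv_cat -!catA.
apply: (word_eq_trans (w2 := [:: (v, b)] ++ ([::] ++ [:: (v, ~~ b)]))).
  apply: word_eq_cat; first exact: word_eq_refl.
  by apply: word_eq_cat => //; exact: word_eq_refl.
exact: word_eq_cancel.
Qed.

Lemma word_eq_inv w1 w2 : word_eq w1 w2 -> word_eq (winv w1) (winv w2).
Proof.
move=> h; apply: (word_eq_trans (w2 := winv w1 ++ (w2 ++ winv w2))).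
  rewrite -[X in word_eq X]cats0; apply: word_eq_cat; first exact: word_eq_refl.
  exact/word_eq_sym/word_eq_mulV.
apply: (word_eq_trans (w2 := (winv w1 ++ w1) ++ winv w2)).
  rewrite catA; apply: word_eq_cat; last exact: word_eq_refl.
  apply: word_eq_cat; [exact: word_eq_refl | exact: word_eq_sym].
rewrite -[X in word_eq _ X]cat0s; apply: word_eq_cat; last exact: word_eq_refl.
by have := word_eq_mulV (winv w1); rewrite winvK.
Qed.

Lemma raag_piM w1 w2 : raag_mul (raag_pi w1) (raag_pi w2) = raag_pi (w1 ++ w2).
Proof.
by apply/raag_piP; apply: word_eq_cat; apply/raag_piP; rewrite raag_reprK.
Qed.

Lemma raag_piV w : raag_inv (raag_pi w) = raag_pi (winv w).
Proof. by apply/raag_piP/word_eq_inv/raag_piP; rewrite raag_reprK. Qed.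

Lemma raag_mulA : associative raag_mul.
Proof.
move=> x y z; rewrite -(raag_reprK x) -(raag_reprK y) -(raag_reprK z).
by rewrite !raag_piM catA.
Qed.

Lemma raag_mul1 : left_id raag_one raag_mul.
Proof. by move=> x; rewrite -(raag_reprK x) raag_piM. Qed.

Lemma raag_mulr1 : right_id raag_one raag_mul.
Proof. by move=> x; rewrite -(raag_reprK x) raag_piM cats0. Qed.

Lemma raag_mulV : left_inverse raag_one raag_inv raag_mul.
Proof.
move=> x; rewrite -(raag_reprK x) raag_piV raag_piM; apply/raag_piP.
by rewrite -[X in _ ++ X]winvK; exact: word_eq_mulV.
Qed.

Lemma raag_mulrV : right_inverse raag_one raag_inv raag_mul.
Proof.
move=> x; rewrite -(raag_reprK x) raag_piV raag_piM; apply/raag_piP.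
exact: word_eq_mulV.
Qed.

HB.instance Definition _ := isGroup.Build raag
  raag_mulA raag_mul1 raag_mulr1 raag_mulV raag_mulrV.

Definition raag_gen (v : V) : raag := raag_pi [:: (v, true)].

End RAAG.

Section GraphMetric.
Variables (T : Type) (E : T -> T -> Prop).

Definition walk (n : nat) (x y : T) : Prop :=
  exists p : nat -> T,
    [/\ p 0%N = x, p n = y & forall i, (i < n)%N -> E (p i) (p i.+1)].

Definition edge_dist (R : realType) (x y : T) : \bar R :=
  ereal_inf [set (n%:R%R)%:E | n in [set n | walk n x y]].

(* An edge {u, v} is encoded as the set [set u; v]. *)
Record subgraph := Subgraph { sverts : set T; sedges : set (set T) }.

Definition path_subgraph (p : int -> T) : subgraph :=
  Subgraph (range p) (range (fun i : int => [set p i; p (i + 1)%R])).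

Definition bi_infinite_geodesic (R : realType) (L : subgraph) : Prop :=
  exists p : int -> T,
    (forall i j : int, edge_dist R (p i) (p j) = (`|i - j|%N%:R%R)%:E) /\
    L = path_subgraph p.

Definition subgraph_map (f : T -> T) (L : subgraph) : subgraph :=
  Subgraph (f @` sverts L) (image (sedges L) (image^~ f)).

End GraphMetric.

Section ExtensionGraph.
Variables (V : finType) (e : rel V).
Local Open Scope group_scope.

Definition ext_verts : set (raag e) :=
  [set x | exists v g, x = raag_gen e v ^ g].

Definition ext_vertex := set_type ext_verts.

Definition ext_adj (x y : ext_vertex) : Prop :=
  x <> y /\ commute (\val x) (\val y).

Lemma ext_act_subproof (x : ext_vertex) (g : raag e) :
  \val x ^ g \in ext_verts.
Proof.
apply/mem_set; have /set_mem[v [h ->]] := valP x.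
by exists v, (h * g); rewrite conjgM.
Qed.

Definition ext_act (x : ext_vertex) (g : raag e) : ext_vertex :=
  SigSub (ext_act_subproof x g).

Definition displacement_rate (R : realType) (g : raag e) (x : ext_vertex) :
    nat -> \bar R :=
  fun n => (edge_dist ext_adj R x (ext_act x (g ^+ n)%g) * (n%:R^-1%R)%:E)%E.

Definition translation_length (R : realType) (g : raag e) (x : ext_vertex) :
  \bar R := limn (displacement_rate R g x).

(* When the graph is connected the limit exists and does not depend on x. *)
Definition loxodromic (R : realType) (g : raag e) : Prop :=
  exists x : ext_vertex,
    cvgn (displacement_rate R g x) /\ (0 < translation_length R g x)%E.

(* L enumerates m distinct subgraphs; [ordS] is the successor modulo m. *)
Definition cyclically_permutes (g : raag e) (m : nat)
    (L : 'I_m -> subgraph ext_vertex) : Prop :=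
  injective L /\
  forall i, subgraph_map (ext_act^~ g) (L i) = L (ordS i).

End ExtensionGraph.

(* Main.v *)
Require Import Defs.
From mathcomp Require Import all_boot all_order all_algebra.
From mathcomp Require Import all_classical all_reals.
From mathcomp Require Import ereal topology normedtype sequences.
From mathcomp Require Import zify.

(** A vertex of the extension graph is a conjugate [q c q^-1] of a generator, and
    it determines [q] up to the star subgroup of [c]. Hence walks of the
    extension graph are walks [u_0, ..., u_n] of the defining graph decorated
    with words, the [i]-th one in the star of [u_i], and such a walk crosses, in
    the star of its centre, every wall that separates its ends.

    Let [h = g^-1] be conjugate to a cyclically reduced word [w]. If two
    cyclically consecutive letters of [w] have adjacent types [u] and [v], both
    walls have to be crossed. Going from the star of one centre to the star of
    the other takes at least three steps by the girth assumption, unless the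
    walk meets one of the centres, so it may be rerouted through them, and
    [{u, v}] is a cut set of geodesics. Otherwise the powers of [w] have a single
    reduced form, and walks may be rerouted through the link of the first letter.
    In both cases every walk between two far translates of a set of at most [N]
    vertices may be rerouted, without becoming longer, through the next
    translate. A closed chain in that set of minimal mean displacement has length
    [m <= N] and unrolls to a geodesic invariant under [g^m]. *)

Set Implicit Arguments.
Unset Strict Implicit.
Unset Printing Implicit Defensive.

Import Order.TTheory GRing.Theory Num.Theory.
Import numFieldNormedType.Exports.

(** * Reduced words *)

Section Words.
Variables (V : finType) (e : rel V).
Hypotheses (e_sym : symmetric e) (e_irr : irreflexive e).

Local Notation letter := (V * bool)%type.
Local Notation word := (word V).

Definition flip (x : letter) : letter := (x.1, ~~ x.2).

Lemma flipK : involutive flip.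
Proof. by case=> v b; rewrite /flip /= negbK. Qed.

Definition tag_letter (v : V) (x : letter) : option bool :=
  if x.1 == v then Some x.2 else None.

(* The stack of [v] in the piling of Crisp, Godelle and Wiest: the letters that
   do not commute with [v], all but those of type [v] being anonymous. *)
Definition stack (v : V) (w : word) : seq (option bool) :=
  [seq tag_letter v x | x <- w & ~~ e v x.1].

(** Only opposite letters clash, and an anonymous entry separates them. A clash in a stack is thus a
    pair of inverse letters that commutations can bring together. *)
Definition compat (a b : option bool) : bool :=
  match a, b with Some x, Some y => x == y | _, _ => true end.

Definition reduced (w : word) : Prop := forall v, sorted compat (stack v w).

(** Equality of all stacks plays the role of equality up to exchanges of adjacent commuting
    letters. *)
Definition teq (w w' : word) : Prop := forall v, stack v w = stack v w'.

Lemma stack_cons v x w :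
  stack v (x :: w) = if e v x.1 then stack v w else tag_letter v x :: stack v w.
Proof. by rewrite /stack /=; case: (e v x.1). Qed.

Lemma stack_cat v w w' : stack v (w ++ w') = stack v w ++ stack v w'.
Proof. by rewrite /stack filter_cat map_cat. Qed.

Lemma teq_sym w w' : teq w w' -> teq w' w.
Proof. by move=> h v. Qed.

Lemma teq_trans w2 w1 w3 : teq w1 w2 -> teq w2 w3 -> teq w1 w3.
Proof. by move=> h h' v; rewrite h h'. Qed.

Lemma teq_cons x w w' : teq w w' -> teq (x :: w) (x :: w').
Proof. by move=> h v; rewrite !stack_cons h. Qed.

Lemma teq_consI x w w' : teq (x :: w) (x :: w') -> teq w w'.
Proof.
by move=> h v; have := h v; rewrite !stack_cons; case: ifP => // _ [].
Qed.

Lemma teq_swap x y w : e x.1 y.1 -> teq (x :: y :: w) (y :: x :: w).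
Proof.
move=> exy v; rewrite !stack_cons /tag_letter.
case: (boolP (e v x.1)) => // /negbTE evx.
case: (boolP (e v y.1)) => // /negbTE evy.
have -> : (x.1 == v) = false.
  by apply: contraFF evy => /eqP <-.
suff -> : (y.1 == v) = false by [].
by apply: contraFF evx => /eqP <-; rewrite e_sym.
Qed.

Lemma reduced_teq w w' : teq w w' -> reduced w -> reduced w'.
Proof. by move=> h r v; rewrite -h. Qed.

Lemma reduced_behead x w : reduced (x :: w) -> reduced w.
Proof.
by move=> r v; have := r v; rewrite stack_cons; case: ifP => // _ /path_sorted.
Qed.

(** [None] means that no inverse of [x] can be moved to the front of [w] and cancelled there. *)
Fixpoint del (x : letter) (w : word) : option word :=
  if w is y :: w' then
    if e x.1 y.1 then omap (cons y) (del x w')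
    else if y == flip x then Some w' else None
  else None.

(* Left multiplication by [x] on reduced words up to commutations. *)
Definition act (x : letter) (w : word) : word := odflt (x :: w) (del x w).

Definition red (w : word) : word := foldr act [::] w.

Lemma del_teq x w w' : del x w = Some w' -> teq w (flip x :: w').
Proof.
elim: w w' => //= y w IH w'; case: ifP => exy.
  case E: (del x w) => [w1|] //= [<-].
  have exy' : e y.1 (flip x).1 by rewrite e_sym.
  exact: teq_trans (teq_cons y (IH _ E)) (teq_swap w1 exy').
by case: eqP => // -> [->].
Qed.

Lemma stack_del x w s :
  stack x.1 w = Some (~~ x.2) :: s -> exists w', del x w = Some w'.
Proof.
elim: w => //= y w IH; rewrite stack_cons; case: ifP => exy.
  by move/IH => [w' ->]; exists (y :: w').
rewrite /tag_letter; case: eqP => // h1 [h2 _].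
by rewrite /flip -h1 -h2; case: (y) => a b; rewrite /= eqxx; exists w.
Qed.

Lemma teq_del x w w' : teq w (flip x :: w') ->
  exists2 w1, del x w = Some w1 & teq w' w1.
Proof.
move=> h; have [|w1 E] := @stack_del x w (stack x.1 w').
  by rewrite h stack_cons /= e_irr /tag_letter /= eqxx.
exists w1 => //; apply: (@teq_consI (flip x)).
exact: teq_trans (teq_sym h) (del_teq E).
Qed.

Lemma act_teq x w w' : teq w w' -> teq (act x w) (act x w').
Proof.
move=> h; rewrite /act; case E: (del x w) => [w1|] /=.
  have [w2 -> h2 //] := teq_del (teq_trans (teq_sym h) (del_teq E)).
case E': (del x w') => [w2|] /=; last exact: teq_cons.
by have [w1 E1] := teq_del (teq_trans h (del_teq E')); rewrite E1 in E.
Qed.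

Lemma act_reduced x w : reduced w -> reduced (act x w).
Proof.
move=> r; rewrite /act; case E: (del x w) => [w1|] /=.
  exact: reduced_behead (reduced_teq (del_teq E) r).
move=> v; rewrite stack_cons; case: ifP => // _.
have := r v; rewrite /= /tag_letter; case: eqP => [vertex_at|_]; last first.
  by case: (stack v w) => //= a s ->; rewrite andbT; case: a.
case P: (stack v w) => [//|a s] /= ->; rewrite andbT.
case: a P => //= b P; case: eqP => // xb.
(* A clash on top of the stack would have let [del] succeed. *)
have [|w' E'] := @stack_del x w s; last by rewrite E' in E.
by rewrite vertex_at P; move: xb; case: (x.2) (b) => [] [].
Qed.

Lemma act_flip x w : reduced w -> teq (act (flip x) (act x w)) w.
Proof.
move=> r; rewrite /act; case E: (del x w) => [w1|] /=; last first.
  by rewrite e_irr flipK eqxx.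
case E1: (del (flip x) w1) => [w2|] /=; last exact: teq_sym (del_teq E).
(* Two successful deletions would put [flip x] and [x] side by side at the front of the reduced word
   [w]. *)
have := reduced_teq (teq_trans (del_teq E) (teq_cons _ (del_teq E1))) r.
rewrite flipK => /(_ x.1); rewrite !stack_cons /= e_irr /tag_letter /= eqxx /=.
by case: (x.2).
Qed.

(** Deletions of letters of adjacent types do not interfere: each is possible after the other if and
    only if it was possible before. *)
Lemma act_comm x y w : e x.1 y.1 -> teq (act x (act y w)) (act y (act x w)).
Proof.
move=> exy; have eyx : e y.1 x.1 by rewrite e_sym.
have delN u v z : e u.1 v.1 -> del u w = Some z -> del v w = None ->
    del v z = None.
  move=> euv Eu Ev; case Ez: (del v z) => [z'|] //.
  have h : teq w (flip v :: flip u :: z').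
    apply: teq_trans (del_teq Eu) _.
    apply: teq_trans (teq_cons _ (del_teq Ez)) _; exact: teq_swap.
  by have [w1 E1] := teq_del h; rewrite E1 in Ev.
have delS u v z z' : e u.1 v.1 -> del u w = Some z -> del v w = Some z' ->
    exists2 z1, del v z = Some z1 & teq w (flip v :: flip u :: z1).
  move=> euv Eu Ev.
  have h := teq_trans (teq_sym (del_teq Eu)) (del_teq Ev).
  have := h v.1; rewrite !stack_cons /= e_irr e_sym euv /tag_letter /= eqxx.
  case/stack_del => z1 E1; exists z1 => //.
  apply: teq_trans (del_teq Eu) _.
  apply: teq_trans (teq_cons _ (del_teq E1)) _; exact: teq_swap.
rewrite {2}/act {3}/act.
case Ex: (del x w) => [wx|]; case Ey: (del y w) => [wy|] /=.
- have [z1 E1 h1] := delS _ _ _ _ exy Ex Ey.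
  have [z2 E2 h2] := delS _ _ _ _ eyx Ey Ex.
  rewrite /act E1 E2 /=; apply: (@teq_consI (flip y)).
  apply: (@teq_consI (flip x)).
  apply: teq_trans (teq_sym h2) (teq_trans h1 _).
  by apply: teq_swap.
- by rewrite /act /= exy Ex /= (delN _ _ _ exy Ex Ey).
- by rewrite /act /= eyx Ey /= (delN _ _ _ eyx Ey Ex).
- by rewrite /act /= exy eyx Ex Ey /=; apply: teq_swap.
Qed.

Lemma foldr_act_reduced w r : reduced r -> reduced (foldr act r w).
Proof. by move=> hr; elim: w => //= x w IH; exact: act_reduced. Qed.

Lemma foldr_act_teq w r r' : teq r r' -> teq (foldr act r w) (foldr act r' w).
Proof. by move=> hr; elim: w => //= x w IH; exact: act_teq. Qed.

(** Van der Waerden's trick: every defining relation acts trivially on reduced words up to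
    commutations, so equal words act alike. *)
Lemma word_eq_act w w' : word_eq e w w' ->
  forall r, reduced r -> teq (foldr act r w) (foldr act r w').
Proof.
elim=> {w w'} //.
- by move=> w1 w2 _ IH r /IH /teq_sym.
- move=> w1 w2 w3 _ IH1 _ IH2 r hr; exact: teq_trans (IH1 r hr) (IH2 r hr).
- move=> w1 w1' w2 w2' _ IH1 _ IH2 r hr; rewrite !foldr_cat.
  apply: teq_trans (foldr_act_teq w1 (IH2 r hr)) _.
  by apply: IH1; exact: foldr_act_reduced.
- move=> v b r hr /=; have := @act_flip (v, ~~ b) r hr.
  by rewrite /flip /= negbK.
- move=> u v euv r hr /=; set s := act (v, true) r.
  have hs : reduced s by exact: act_reduced.
  apply: teq_trans (act_teq (u, false) (act_comm (x := (v, false))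
    (y := (u, true)) s _)) _; first by rewrite e_sym.
  apply: teq_trans (@act_flip (u, true) _ (act_reduced _ hs)) _.
  exact: (@act_flip (v, true)).
Qed.

Lemma red_reduced w : reduced (red w).
Proof. exact: foldr_act_reduced. Qed.

Lemma red_id w : reduced w -> red w = w.
Proof.
elim: w => //= x w IH r; rewrite (IH (reduced_behead r)) /act.
case E: (del x w) => [w1|] //=.
have := reduced_teq (teq_cons x (del_teq E)) r x.1.
rewrite !stack_cons /= e_irr /tag_letter /= eqxx /=.
by case: (x.2).
Qed.

(** Both words are applied to the empty word, whence uniqueness of reduced forms up to
    commutations. *)
Lemma word_eq_teq w w' : reduced w -> word_eq e w w' -> teq w (red w').
Proof.
by move=> r /word_eq_act /(_ [::] (fun=> isT)); rewrite -/(red w) red_id.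
Qed.

Lemma del_subseq x w w' : del x w = Some w' -> subseq w' w.
Proof.
elim: w w' => //= y w IH w'; case: ifP => exy.
  by case E: (del x w) => [w1|] //= [<-] /=; rewrite eqxx; exact: IH.
by case: eqP => // _ [<-]; exact: subseq_cons.
Qed.

Lemma red_subseq w : subseq (red w) w.
Proof.
elim: w => // x w IH; rewrite -[red (x :: w)]/(act x (red w)) /act.
case E: (del x (red w)) => [w1|]; last by rewrite /= eqxx.
exact: subseq_trans (subseq_trans (del_subseq E) IH) (subseq_cons w x).
Qed.

Lemma teq_front x w w' : teq (x :: w) w' ->
  exists2 w1, del (flip x) w' = Some w1 & teq w w1.
Proof. by move/teq_sym => h; apply: teq_del; rewrite flipK. Qed.

Lemma del_size x w w' : del x w = Some w' -> size w = (size w').+1.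
Proof.
elim: w w' => //= y w IH w'; case: ifP => exy.
  by case E: (del x w) => [w1|] //= [<-] /=; rewrite (IH _ E).
by case: eqP => // _ [<-].
Qed.

Lemma teq_nil w : teq [::] w -> w = [::].
Proof.
by case: w => // x w /(_ x.1); rewrite stack_cons e_irr.
Qed.

Lemma teq_size w w' : teq w w' -> size w = size w'.
Proof.
elim: w w' => [w' /teq_nil -> //|x w IH w' /teq_front [w1 E /IH /= ->]].
by rewrite (del_size E).
Qed.

(** Without two consecutive letters of adjacent types no exchange is possible, so the word is alone
    in its class. *)
Lemma teq_rigid w w' :
  sorted (fun x y : letter => ~~ e x.1 y.1) w -> teq w w' -> w = w'.
Proof.
elim: w w' => [w' _ /teq_nil -> //|x w IH w' s /teq_front [w1 E h]].
have := IH w1 (path_sorted s) h => ?; subst w1.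
case: w' E => //= y w'; case: ifP => exy.
  case: (del _ w') => [w2|] //= [hw]; subst w.
  by move: s; rewrite /= exy.
by case: eqP => // -> [->]; rewrite flipK.
Qed.

End Words.

(** * Walls, retractions and centralizers *)

Section Group.
Variables (V : finType) (e : rel V).
Hypotheses (e_sym : symmetric e) (e_irr : irreflexive e).

Local Open Scope group_scope.

Local Notation letter := (V * bool)%type.
Local Notation word := (word V).
Local Notation G := (raag e).
Local Notation pi := (raag_pi e).
Local Notation gen := (raag_gen e).

Lemma pi_cat w w' : pi (w ++ w') = pi w * pi w'.
Proof. by symmetry; exact: raag_piM. Qed.

Lemma pi_nil : pi [::] = 1.
Proof. by []. Qed.

Lemma pi_cons x w : pi (x :: w) = pi [:: x] * pi w.
Proof. by rewrite -pi_cat. Qed.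

Lemma pi_winv w : pi (winv w) = (pi w)^-1.
Proof. by symmetry; exact: raag_piV. Qed.

Lemma pi_flip x : pi [:: flip x] = (pi [:: x])^-1.
Proof. by rewrite -pi_winv. Qed.

Lemma pi_letter x : pi [:: x] = if x.2 then gen x.1 else (gen x.1)^-1.
Proof. by case: x => v [] //; rewrite -pi_winv. Qed.

Lemma commuteVl (x y : G) : commute x y -> commute x^-1 y.
Proof. by move=> h; apply/commute_sym/commuteV/commute_sym. Qed.

Lemma gen_comm u v : e u v -> commute (gen u) (gen v).
Proof.
move=> /(@word_eq_comm V e) /raag_piP.
rewrite pi_cons (pi_cons (v, false)) (pi_cons (u, true)) pi_nil !pi_letter /=.
move=> h; rewrite /commute -[RHS]mulg1 -h.
by rewrite !mulgA mulgK mulgV mul1g.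
Qed.

Definition in_star (c : V) : pred letter := [pred x | (x.1 == c) || e c x.1].

Definition star_group (c : V) (h : G) : Prop :=
  exists2 w, all (in_star c) w & h = pi w.

Lemma letter_comm (x y : letter) : e x.1 y.1 -> commute (pi [:: x]) (pi [:: y]).
Proof.
move=> /gen_comm h; rewrite !pi_letter.
by case: (x.2); case: (y.2) => //; try apply: commuteVl; try apply: commuteV.
Qed.

Lemma in_star_commute c (x : letter) :
  in_star c x -> commute (gen c) (pi [:: x]).
Proof.
case/orP => [/eqP <-|h]; rewrite pi_letter.
  by case: (x.2) => //; apply: commuteV.
by case: (x.2); [|apply: commuteV]; exact: gen_comm.
Qed.

Lemma star_group_commute c h : star_group c h -> commute (gen c) h.
Proof.
case=> w + ->; elim: w => [_|x w IH /= /andP[hx hw]]; first exact: commute1.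
by rewrite pi_cons; apply: commuteM; [exact: in_star_commute|exact: IH].
Qed.

Lemma star_groupM c h h' :
  star_group c h -> star_group c h' -> star_group c (h * h').
Proof.
case=> [w hw ->] [w' hw' ->]; exists (w ++ w'); last by rewrite pi_cat.
by rewrite all_cat hw.
Qed.

Lemma star_groupV c h : star_group c h -> star_group c h^-1.
Proof.
case=> w hw ->; exists (winv w); last by rewrite pi_winv.
by rewrite /winv all_rev all_map; apply: sub_all hw => -[].
Qed.

(** The inverse turns the right action by [g] into left multiplication of [q] by the inverse of
    [g]. *)
Definition conj_gen (q : G) (c : V) : G := gen c ^ q^-1.

Lemma conj_genE q c : conj_gen q c = q * gen c * q^-1.
Proof. by rewrite /conj_gen conjgE invgK mulgA. Qed.

Lemma conj_genM q h c : conj_gen (q * h) c = conj_gen h c ^ q^-1.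
Proof. by rewrite /conj_gen invgM conjgM. Qed.

Lemma conj_gen_star q h c : star_group c h -> conj_gen (q * h) c = conj_gen q c.
Proof.
move=> /star_group_commute hc; rewrite conj_genM /conj_gen; congr (_ ^ _).
by rewrite conjgE invgK mulgA -hc mulgK.
Qed.

Lemma pi_del x w w' : del e x w = Some w' -> pi (x :: w) = pi w'.
Proof.
elim: w w' => //= y w IH w'; case: ifP => exy.
  case E: (del e x w) => [w1|] //= [<-].
  rewrite (pi_cons x) (pi_cons y w) (pi_cons y w1) -(IH _ E) (pi_cons x w).
  rewrite !mulgA.
  by congr (_ * _); exact: letter_comm.
case: eqP => // -> [->]; rewrite (pi_cons x) (pi_cons (flip x)) pi_flip.
exact: mulVKg.
Qed.

Lemma pi_red w : pi (red e w) = pi w.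
Proof.
elim: w => //= x w IH; rewrite /act pi_cons -IH -pi_cons.
by case E: (del e x (red e w)) => [w1|] //=; rewrite (pi_del E).
Qed.

Lemma reduced_word_ex (h : G) : exists2 w, h = pi w & reduced e w.
Proof.
exists (red e (raag_repr h)); last exact: red_reduced.
by rewrite pi_red raag_reprK.
Qed.

Lemma pi_teq w w' : reduced e w -> pi w = pi w' -> teq e w (red e w').
Proof. by move=> r /raag_piP; apply: word_eq_teq. Qed.

Lemma gen_neq1 v : gen v <> 1.
Proof.
have r : reduced e [:: (v, true)].
  by move=> u; rewrite stack_cons; case: ifP.
by move=> /(pi_teq (w' := [::]) r) /(_ v); rewrite stack_cons /= e_irr.
Qed.

(* The walls crossed by the path of the Cayley graph that starts at [q] and is
   labelled by [w]; a wall is encoded by the centre of its star. *)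
Fixpoint walls (q : G) (w : word) : seq (G * letter) :=
  if w is x :: w' then (conj_gen q x.1, x) :: walls (q * pi [:: x]) w'
  else [::].

Lemma walls_cat q w w' :
  walls q (w ++ w') = walls q w ++ walls (q * pi w) w'.
Proof.
elim: w q => [|x w IH] q /=; first by rewrite pi_nil mulg1.
by rewrite IH (pi_cons x w) mulgA.
Qed.

Lemma walls_split q w (s : G) (x : letter) : (s, x) \in walls q w ->
  exists w1 w2, w = w1 ++ x :: w2 /\ s = conj_gen (q * pi w1) x.1.
Proof.
elim: w q => //= y w IH q; rewrite inE => /orP[/eqP[-> ->]|/IH].
  by exists [::], w; rewrite pi_nil mulg1.
by move=> [w1 [w2 [-> ->]]]; exists (y :: w1), w2; rewrite (pi_cons y w1) mulgA.
Qed.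

Lemma mem_walls q w1 (x : letter) w2 :
  (conj_gen (q * pi w1) x.1, x) \in walls q (w1 ++ x :: w2).
Proof. by rewrite walls_cat mem_cat /= inE eqxx orbT. Qed.

Lemma conj_gen_letter q (x : letter) c :
  in_star c x -> conj_gen (q * pi [:: x]) c = conj_gen q c.
Proof. by move=> h; apply: conj_gen_star; exists [:: x] => //=; rewrite h. Qed.

Lemma adj_in_star (x y : letter) : e x.1 y.1 -> in_star y.1 x.
Proof. by move=> h; rewrite /in_star /= e_sym h orbT. Qed.

(** A letter of adjacent type preserves a wall, so [x] can be moved up to its inverse without
    changing the walls in between; the cancellation only loses walls. *)
Lemma walls_del q x w w' : del e x w = Some w' ->
  {subset walls q w' <= walls (q * pi [:: x]) w}.
Proof.
elim: w w' q => //= y w IH w' q; case: ifP => exy.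
  case E: (del e x w) => [w1|] //= [<-] sx; rewrite !inE.
  rewrite (conj_gen_letter q (adj_in_star exy)).
  case: eqP => //= _ /(IH _ _ E); rewrite -!mulgA.
  by rewrite (letter_comm exy).
case: eqP => // -> [->] sx; rewrite inE pi_flip mulgK => ->.
by rewrite orbT.
Qed.

Lemma walls_act q x w : {subset walls q (act e x w) <= walls q (x :: w)}.
Proof.
rewrite /act; case E: (del e x w) => [w1|] //= sx /(walls_del E).
by rewrite inE => ->; rewrite orbT.
Qed.

Lemma walls_red q w : {subset walls q (red e w) <= walls q w}.
Proof.
elim: w q => //= x w IH q sx /walls_act /=; rewrite !inE.
by case/orP => [->//|/IH ->]; rewrite orbT.
Qed.

Lemma walls_del_head q x w w' : del e x w = Some w' ->
  (conj_gen q x.1, flip x) \in walls q w.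
Proof.
elim: w w' q => //= y w IH w' q; case: ifP => exy.
  case E: (del e x w) => [w1|] //= _; rewrite inE.
  have := IH _ (q * pi [:: y]) E; rewrite conj_gen_letter => [->|].
    by rewrite orbT.
  by apply: adj_in_star; rewrite e_sym.
by case: eqP => // -> _; rewrite inE eqxx.
Qed.

Lemma walls_teq q w w' : teq e w w' -> {subset walls q w <= walls q w'}.
Proof.
elim: w w' q => //= x w IH w' q /(teq_front e_sym e_irr)[w1 E h] sx.
rewrite inE => /orP[/eqP->|/(IH _ _ h)].
  by have := walls_del_head q E; rewrite flipK.
by move/(walls_del E); rewrite pi_flip mulgK.
Qed.

(** Reduction only loses walls and commutations preserve them, so a reduced path crosses only walls
    that separate its ends. *)
Lemma walls_pi q w w' : reduced e w -> pi w = pi w' ->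
  {subset walls q w <= walls q w'}.
Proof.
by move=> r /(pi_teq r) h sx /(walls_teq h); apply: walls_red.
Qed.

(** Erasing the letters of type outside [T] sends each relator to a relator, a cancelling pair or
    the empty word; this yields the retraction [ret T]. *)
Lemma word_eq_filter (T : pred V) w w' : word_eq e w w' ->
  word_eq e [seq x <- w | T x.1] [seq x <- w' | T x.1].
Proof.
elim=> {w w'}.
- by move=> w; exact: word_eq_refl.
- by move=> w w' _; exact: word_eq_sym.
- by move=> w1 w2 w3 _ h _; exact: word_eq_trans.
- by move=> w1 w1' w2 w2' _ h1 _ h2; rewrite !filter_cat; exact: word_eq_cat.
- move=> v b /=; case: (T v); last exact: word_eq_refl.
  exact: word_eq_cancel.
- move=> u v euv /=; case: (T u); case: (T v).
  + exact: word_eq_comm.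
  + exact: (word_eq_cancel e u false).
  + exact: (word_eq_cancel e v false).
  + exact: word_eq_refl.
Qed.

Definition ret (T : pred V) (h : G) : G :=
  pi [seq x <- raag_repr h | T x.1].

Lemma ret_pi T w : ret T (pi w) = pi [seq x <- w | T x.1].
Proof. by apply/raag_piP/word_eq_filter/raag_piP; exact: raag_reprK. Qed.

Lemma retM T h h' : ret T (h * h') = ret T h * ret T h'.
Proof.
have [w -> _] := reduced_word_ex h; have [w' -> _] := reduced_word_ex h'.
by rewrite -pi_cat !ret_pi filter_cat pi_cat.
Qed.

Lemma ret1 T : ret T 1 = 1.
Proof. exact: (ret_pi T [::]). Qed.

Lemma retV T h : ret T h^-1 = (ret T h)^-1.
Proof. by apply: (mulgI (ret T h)); rewrite -retM !mulgV ret1. Qed.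

Lemma ret_gen (T : pred V) v : ret T (gen v) = if T v then gen v else 1.
Proof. by rewrite ret_pi /=; case: (T v). Qed.

Definition star (c : V) : pred V := [pred v | (v == c) || e c v].

Lemma ret_star c h : star_group c (ret (star c) h).
Proof.
have [w -> _] := reduced_word_ex h; rewrite ret_pi.
by exists [seq x <- w | star c x.1] => //; rewrite filter_all.
Qed.

Lemma ret_star_group c h : star_group c h -> ret (star c) h = h.
Proof. by case=> w hw ->; rewrite ret_pi; congr pi; exact/all_filterP. Qed.

Lemma rcons_rot_nseq (T : eqType) (a : T) s :
  a :: s = rcons s a -> s = nseq (size s) a.
Proof. by elim: s => //= b s IH [<- /IH {1}->]. Qed.

(* Equating the stacks of [v] in [v w] and [w v] shows that the stack of [v] in
   [w] is constant, so that every letter of [w] lies in the star of [v]. *)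
Lemma centralizer v h : commute (gen v) h -> star_group v h.
Proof.
have [w -> r] := reduced_word_ex h => hc.
(* If [v] cancels in [w], then [w] starts with its inverse up to commutations, and one more such
   inverse in front keeps the word reduced. *)
have [b rb] : exists b, reduced e ((v, b) :: w).
  case E: (del e (v, true) w) => [w1|]; last first.
    by exists true; have := act_reduced e_sym (v, true) r; rewrite /act E.
  have hE := del_teq e_sym E; have r1 := reduced_teq hE r.
  exists false; apply: (reduced_teq (teq_cons _ (teq_sym hE))) => u.
  have := r1 u; rewrite !stack_cons; case: ifP => // _ /= ->.
  by rewrite andbT /tag_letter /=; case: eqP.
have hp : pi ((v, b) :: w) = pi (rcons w (v, b)).
  rewrite -cats1 pi_cat pi_cons pi_letter /=.
  by case: (b) => //; apply: commuteVl.
have h1 := pi_teq rb hp.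
(* The reduced word [(v, b) :: w] is just as long, so nothing cancels in [rcons w (v, b)]. *)
have hr : red e (rcons w (v, b)) = rcons w (v, b).
  have /size_subseq_leqif /leqifP := red_subseq e (rcons w (v, b)).
  case: eqP => // _; rewrite -(teq_size e_sym e_irr h1) size_rcons.
  by rewrite ltnn.
have := h1 v; rewrite hr -cats1 stack_cat !stack_cons /= e_irr cats1.
move=> /rcons_rot_nseq; rewrite {1}/tag_letter /= eqxx => hn.
exists w => //; apply/allP => y yw; rewrite /in_star /=.
case ev: (e v y.1); first by rewrite orbT.
have : tag_letter v y \in stack e v w.
  by apply: map_f; rewrite mem_filter ev yw.
by rewrite hn mem_nseq /tag_letter; case: (y.1 == v); rewrite ?andbF.
Qed.

(** The retraction onto the cyclic group of [c] distinguishes types; for equal types, [q^-1 * q']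
    centralizes the generator. *)
Lemma conj_gen_inj q q' c c' :
  conj_gen q c = conj_gen q' c' -> c = c' /\ star_group c (q^-1 * q').
Proof.
move=> h; have cc : c = c'.
  apply/eqP/negPn/negP => nc.
  have := congr1 (ret (pred1 c)) h.
  rewrite !conj_genE !retM !retV !ret_gen /= eqxx eq_sym (negbTE nc) mulg1.
  rewrite mulgV.
  move/(congr1 (conjg^~ (ret (pred1 c) q))); rewrite conj1g conjgE !mulgA.
  by rewrite mulVg mul1g mulgVK => /gen_neq1.
split => //; subst c'; apply: centralizer; move: h; rewrite !conj_genE => h.
rewrite /commute; apply: (mulgI q); rewrite !mulgA mulgV mul1g.
apply: (mulIg q'^-1); rewrite -[RHS]h.
by rewrite -!mulgA mulgV mulg1.
Qed.

(* With [rho] the retraction onto the star subgroup of [c'] and [h = q^-1 q'],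
   the factorization [h = (h rho(h)^-1) rho(h)] gives [k]. *)
Lemma commute_conj_gen q q' c c' : conj_gen q c <> conj_gen q' c' ->
  commute (conj_gen q c) (conj_gen q' c') ->
  e c c' /\ exists2 k, star_group c k & conj_gen q' c' = conj_gen (q * k) c'.
Proof.
have [h ->] : exists h, q' = q * h by exists (q^-1 * q'); rewrite mulVKg.
move=> ne com.
have com1 : commute (gen c) (conj_gen h c').
  apply: (conjg_inj q^-1).
  rewrite (conjMg (gen c) (conj_gen h c')) (conjMg (conj_gen h c') (gen c)).
  by rewrite -conj_genM.
pose z := gen c ^ h.
have zs : star_group c' z.
  apply: centralizer; apply: (conjg_inj h^-1).
  by rewrite (conjMg (gen c') z) (conjMg z (gen c')) /z conjgK.
(* The retraction onto the star of [c'] fixes [z], but would kill it if [c] were outside that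
   star. *)
have cc' : star c' c.
  apply/negPn/negP => nc; have := ret_star_group zs.
  rewrite /z conjgE !retM ret_gen (negbTE nc) mul1g retV mulVg => /esym.
  by move=> /eqP; rewrite -conjgE conjg_eq1 => /eqP/gen_neq1.
have ks : star_group c (h * (ret (star c') h)^-1).
  apply: centralizer; have := ret_star_group zs.
  rewrite /z !conjgE !retM retV ret_gen cc' => hz.
  rewrite /commute; apply: (mulgI h^-1); apply: (mulIg (ret (star c') h)).
  rewrite -!mulgA mulVg mulg1 -hz.
  by rewrite !mulgA mulVg mul1g.
have hv : conj_gen (q * h) c' = conj_gen (q * (h * (ret (star c') h)^-1)) c'.
  by rewrite mulgA [RHS]conj_gen_star //; apply: star_groupV; exact: ret_star.
split; last by exists (h * (ret (star c') h)^-1).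
case/orP: cc'; last by rewrite e_sym.
by move=> /eqP cc; subst c'; case: ne; rewrite hv conj_gen_star.
Qed.

Lemma conj_gen_commute q c c' :
  e c c' -> commute (conj_gen q c) (conj_gen q c').
Proof. by move=> /gen_comm h; rewrite /commute /conj_gen -!conjMg h. Qed.

Lemma conj_gen_neq q c c' : e c c' -> conj_gen q c <> conj_gen q c'.
Proof. by move=> ec /conj_gen_inj[cc _]; rewrite cc e_irr in ec. Qed.

End Group.

(** * Walks in the extension graph *)

Section Walks.
Variables (T : Type) (E : T -> T -> Prop).

Lemma walk0 x : walk E 0 x x.
Proof. by exists (fun=> x). Qed.

Lemma walk0_eq x y : walk E 0 x y -> x = y.
Proof. by case=> p [<- <-]. Qed.

Lemma walkS n x y z : E x y -> walk E n y z -> walk E n.+1 x z.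
Proof.
move=> exy [p [p0 pn pE]]; exists (fun i => if i is j.+1 then p j else x).
by split=> // -[|i] /=; [rewrite p0|exact: pE].
Qed.

Lemma walkS_ex n x z : walk E n.+1 x z -> exists2 y, E x y & walk E n y z.
Proof.
case=> p [<- <- pE]; exists (p 1%N); first exact: (pE 0%N).
by exists (fun i => p i.+1); split=> // i hi; exact: pE.
Qed.

Lemma walk1 x y : E x y -> walk E 1 x y.
Proof. by move=> h; apply: walkS h (walk0 y). Qed.

Lemma walk_cat m n x y z : walk E m x y -> walk E n y z -> walk E (m + n) x z.
Proof.
elim: m x => [x /walk0_eq -> //|m IH x /walkS_ex [x' ex hx] hy].
exact: walkS ex (IH _ hx hy).
Qed.

Lemma walk_rev n x y :
  (forall a b, E a b -> E b a) -> walk E n x y -> walk E n y x.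
Proof.
move=> Es; elim: n x => [x /walk0_eq ->|n IH x /walkS_ex [x' ex hx]].
  exact: walk0.
by rewrite -addn1; apply: walk_cat (IH _ hx) (walk1 (Es _ _ ex)).
Qed.

Lemma walk_map (f : T -> T) n x y : (forall a b, E a b -> E (f a) (f b)) ->
  walk E n x y -> walk E n (f x) (f y).
Proof.
move=> fE [p [<- <- pE]]; exists (f \o p); split=> // i hi.
by apply: fE; exact: pE.
Qed.

End Walks.

Section Reach.
Variables (V : finType) (e : rel V).
Hypotheses (e_sym : symmetric e) (e_irr : irreflexive e).

Local Open Scope group_scope.

Local Notation word := (word V).
Local Notation G := (raag e).
Local Notation pi := (raag_pi e).
Local Notation adj := (@ext_adj V e).

Lemma conj_gen_ext (q : G) (c : V) : conj_gen q c \in @ext_verts V e.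
Proof. by apply/mem_set; exists c, q^-1. Qed.

Definition vertex_at (q : G) (c : V) : ext_vertex e :=
  SigSub (conj_gen_ext q c).

Lemma vertex_at_eq q q' c c' :
  conj_gen q c = conj_gen q' c' -> vertex_at q c = vertex_at q' c'.
Proof. by move=> h; apply: val_inj. Qed.

Lemma vertex_at_inj q q' c c' :
  vertex_at q c = vertex_at q' c' -> conj_gen q c = conj_gen q' c'.
Proof. by move/(congr1 val). Qed.

Lemma vertex_at_ex x : exists q c, x = vertex_at q c.
Proof.
have /set_mem [c [g h]] := valP x; exists g^-1, c; apply: val_inj.
by rewrite h /= /conj_gen invgK.
Qed.

Lemma vertex_at_star q h c :
  star_group c h -> vertex_at (q * h) c = vertex_at q c.
Proof. by move=> h'; apply: vertex_at_eq; exact: conj_gen_star. Qed.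

Lemma adj_sym x y : adj x y -> adj y x.
Proof. by case=> h c; split; [move/esym|exact: commute_sym]. Qed.

Lemma adj_vertex_at q c c' : e c c' -> adj (vertex_at q c) (vertex_at q c').
Proof.
move=> h; split; last exact: conj_gen_commute.
by move/vertex_at_inj; exact: conj_gen_neq.
Qed.

Lemma adj_vertex_atP q q' c c' : adj (vertex_at q c) (vertex_at q' c') ->
  e c c' /\ exists2 k, star_group c k & vertex_at q' c' = vertex_at (q * k) c'.
Proof.
case=> ne com; have [|ec [k hk h]] := commute_conj_gen e_sym e_irr _ com.
  by move=> h; apply: ne; exact: vertex_at_eq.
by split=> //; exists k => //; exact: vertex_at_eq.
Qed.

(* Walks in the defining graph decorated with words. *)
Inductive reach : nat -> V -> word -> V -> Prop :=
| reach_nil c : reach 0 c [::] c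
| reach_letter n c x w d :
    in_star e c x -> reach n c w d -> reach n c (x :: w) d
| reach_step n c c' w d : e c c' -> reach n c' w d -> reach n.+1 c w d.

Lemma reach_walk n c w d : reach n c w d ->
  forall q, walk adj n (vertex_at q c) (vertex_at (q * pi w) d).
Proof.
elim=> {n c w d}.
- by move=> c q; rewrite pi_nil mulg1; exact: walk0.
- move=> n c x w d hx _ IH q; rewrite (pi_cons e x w) mulgA.
  rewrite -(@vertex_at_star q (pi [:: x]) c); first exact: IH.
  by exists [:: x]; rewrite //= hx.
- move=> n c c' w d ec _ IH q; apply: walkS (IH q); exact: adj_vertex_at.
Qed.

Lemma reach_cat n c w d : reach n c w d -> forall m w' d', reach m d w' d' ->
  reach (n + m) c (w ++ w') d'.
Proof.
elim=> {n c w d} // [n c x w d hx _ IH|n c c' w d ec _ IH] m w' d' h /=.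
  by apply: reach_letter => //; exact: IH.
by apply: reach_step ec _; exact: IH.
Qed.

Lemma reach_star c w : all (in_star e c) w -> reach 0 c w c.
Proof.
elim: w => [_|x w IH /= /andP[hx hw]]; first exact: reach_nil.
by apply: reach_letter => //; exact: IH.
Qed.

(** At each step the coset representative changes by an element of a star subgroup, and these
    corrections spell [w]. *)
Lemma walk_reach n q c q' d : walk adj n (vertex_at q c) (vertex_at q' d) ->
  exists2 w, q' = q * pi w & reach n c w d.
Proof.
elim: n q c => [|n IH] q c.
  move=> h; have h0 := vertex_at_inj (walk0_eq h).
  have [<- [w hw h']] := conj_gen_inj e_sym e_irr h0.
  by exists w; [rewrite -h' mulVKg|exact: reach_star].
move=> h; have [y] := walkS_ex h; have [q1 [c1 ->]] := vertex_at_ex y.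
case/adj_vertex_atP => ec [k [w1 hw1 ->] ->] /IH [w -> hw].
exists (w1 ++ w); first by rewrite pi_cat mulgA.
by apply: (reach_cat (reach_star hw1)); exact: reach_step ec hw.
Qed.

Lemma reach_split n c w d : reach n c w d -> forall w1 w2, w = w1 ++ w2 ->
  exists n1 n2 b, [/\ (n1 + n2)%N = n, reach n1 c w1 b & reach n2 b w2 d].
Proof.
elim=> {n c w d}.
- move=> c [|//] [|//] _; exists 0%N, 0%N, c; split=> //; exact: reach_nil.
- move=> n c x w d hx hr IH [|y w1] w2 /=.
    move=> <-; exists 0%N, n, c; split=> //; first exact: reach_nil.
    exact: reach_letter.
  move=> [<- /IH [n1 [n2 [b [<- h1 h2]]]]]; exists n1, n2, b; split=> //.
  exact: reach_letter.
- move=> n c c' w d ec _ IH w1 w2 /IH [n1 [n2 [b [<- h1 h2]]]].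
  by exists n1.+1, n2, b; split=> //; exact: reach_step ec h1.
Qed.

Lemma reach_letterI n c w d : reach n c w d -> forall x w2, w = x :: w2 ->
  exists n1 n2 b, [/\ (n1 + n2)%N = n, reach n1 c [::] b, in_star e b x &
    reach n2 b (x :: w2) d].
Proof.
elim=> {n c w d} //.
- move=> n c x w d hx hr IH _ _ [<- <-]; exists 0%N, n, c.
  by split=> //; [exact: reach_nil|exact: reach_letter].
- move=> n c c' w d ec _ IH x w2 /IH [n1 [n2 [b [<- h1 h2 h3]]]].
  by exists n1.+1, n2, b; split=> //; exact: reach_step ec h1.
Qed.

Lemma reach_at n c w1 x w2 d : reach n c (w1 ++ x :: w2) d ->
  exists n1 n2 b, [/\ (n1 + n2)%N = n, reach n1 c w1 b, in_star e b x &
    reach n2 b (x :: w2) d].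
Proof.
move=> /reach_split /(_ _ _ erefl) [n1 [n2 [b [<- h1]]]].
case/reach_letterI/(_ _ _ erefl) => m1 [m2 [b' [<- h2 hx h3]]].
exists (n1 + m1)%N, m2, b'; rewrite addnA; split=> //.
by rewrite -[w1]cats0; exact: reach_cat h1 _ _ _ h2.
Qed.

(** Letters are read without moving, so omitting some leaves a walk of the same length; in
    particular words may be reduced. *)
Lemma reach_subseq n c w d : reach n c w d -> forall w', subseq w' w ->
  reach n c w' d.
Proof.
elim=> {n c w d}.
- by move=> c w'; rewrite subseq0 => /eqP ->; exact: reach_nil.
- move=> n c x w d hx hr IH [|y w'] /=.
    by move=> _; apply: IH; exact: sub0seq.
  case: eqP => [->|_] h; last exact: IH.
  by apply: reach_letter => //; exact: IH.
- by move=> n c c' w d ec _ IH w' /IH; exact: reach_step.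
Qed.

Lemma reach_red n c w d : reach n c w d -> reach n c (red e w) d.
Proof. by move=> h; apply: reach_subseq h _ _; exact: red_subseq. Qed.

Lemma reach_types n c w d : reach n c w d -> walk e n c d.
Proof.
elim=> {n c w d} // [c|n c c' w d ec _]; first exact: walk0.
exact: walkS.
Qed.

End Reach.

(** * Squares in the extension graph *)

Section Girth.
Variables (V : finType) (e : rel V).
Hypotheses (e_sym : symmetric e) (e_irr : irreflexive e).
Hypothesis girth6 : forall c, embedded_cycle e c -> (6 <= size c)%N.

Lemma edge_neq a b : e a b -> a != b.
Proof. by apply: contraTneq => ->; rewrite e_irr. Qed.

Lemma no_triangle a b c : e a b -> e b c -> e c a -> False.
Proof.
move=> ab bc ca; have := @girth6 [:: a; b; c]; apply: contraPP => _.
apply/not_implyP; split=> //; split=> //; rewrite /ucycle /= ab bc ca /= !inE.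
by rewrite !negb_or (edge_neq ab) (edge_neq bc) edge_neq // e_sym.
Qed.

Lemma no_square a b c d : e a b -> e b c -> e c d -> e d a -> a = c \/ b = d.
Proof.
move=> ab bc cd da.
case: (eqVneq a c) => [|ac]; first by left.
case: (eqVneq b d) => [|bd]; first by right.
have := @girth6 [:: a; b; c; d]; apply: contraPP => _.
apply/not_implyP; split=> //; split=> //.
rewrite /ucycle /= ab bc cd da /= !inE.
rewrite !negb_or ac bd (edge_neq ab) (edge_neq bc) (edge_neq cd).
by rewrite edge_neq // e_sym.
Qed.

Lemma no_pentagon a b c d f :
  e a b -> e b c -> e c d -> e d f -> e f a -> False.
Proof.
move=> ab bc cd df fa.
case: (eqVneq a c) => [h|ac]; first by subst c; apply: no_triangle cd df fa.
case: (eqVneq a d) => [h|ad]; first by subst d; apply: no_triangle ab bc cd.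
case: (eqVneq b d) => [h|bd]; first by subst d; apply: no_triangle df fa ab.
case: (eqVneq b f) => [h|bf]; first by subst f; apply: no_triangle bc cd df.
case: (eqVneq c f) => [h|cf]; first by subst f; apply: no_triangle ab bc fa.
have := @girth6 [:: a; b; c; d; f]; apply: contraPP => _.
apply/not_implyP; split=> //; split=> //.
rewrite /ucycle /= ab bc cd df fa /= !inE.
rewrite !negb_or ac ad bd bf cf (edge_neq ab) (edge_neq bc) (edge_neq cd).
by rewrite (edge_neq df) edge_neq // e_sym.
Qed.

Local Open Scope group_scope.

Local Notation word := (word V).
Local Notation G := (raag e).
Local Notation pi := (raag_pi e).
Local Notation adj := (@ext_adj V e).
Local Notation vertex_at := (@vertex_at V e).
Local Notation conj_gen := (@conj_gen V e).
Local Notation in_star := (@in_star V e).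
Local Notation star_group := (@star_group V e).

Lemma adj_type q q' c c' : adj (vertex_at q c) (vertex_at q' c') -> e c c'.
Proof. by move=> h; have [] := adj_vertex_atP e_sym e_irr h. Qed.

(* An element [h] of the star subgroup of [y] moves one vertex of type [a] to the
   other. A letter of [h] outside the star of [a] is the centre of a wall whose
   star contains both [y] and [y']. *)
Lemma ext_no_square_same_type q q' a (y y' : ext_vertex e) :
  adj (vertex_at q a) y -> adj y (vertex_at q' a) ->
  adj (vertex_at q' a) y' -> adj y' (vertex_at q a) ->
  vertex_at q a = vertex_at q' a \/ y = y'.
Proof.
have [q2 [b ->]] := vertex_at_ex y; have [q4 [c ->]] := vertex_at_ex y'.
move=> /adj_sym h1 h2 /adj_sym h3 /adj_sym h4.
have [eba [l hl xl]] := adj_vertex_atP e_sym e_irr h1.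
have [_ [l' hl' xl']] := adj_vertex_atP e_sym e_irr h2.
rewrite -(vertex_at_star q2 hl) xl xl'; move: h3 h4; rewrite xl xl'.
have [h hh ->] : exists2 h, star_group b h & l' = l * h.
  exists (l^-1 * l'); last by rewrite mulVKg.
  by apply: star_groupM => //; exact: star_groupV.
rewrite mulgA; move: (q2 * l) => {h1 h2 xl xl' hl hl' l l' q2 q q'} q h3 h4.
have [eac [k [K hK ->] yk]] := adj_vertex_atP e_sym e_irr h4.
move: h3; rewrite yk => h3.
have [_ [m [M hM ->] xm]] := adj_vertex_atP e_sym e_irr h3.
have [_ [N hN hkm]] := conj_gen_inj e_sym e_irr (esym (vertex_at_inj xm)).
(* Going round by the other side writes [h] with letters in the stars of [a], [c] and [a] again. *)
have {hkm xm yk h3 h4}hE : h = pi (K ++ M ++ N).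
  by apply: (mulgI q); rewrite !pi_cat !mulgA -hkm mulVKg.
have [H0 hH0 hH] := hh.
have rH := red_reduced e_sym H0.
have {}hH0 : all (in_star b) (red e H0).
  by apply/allP => x /(mem_subseq (red_subseq e H0)); apply: (allP hH0).
rewrite -(pi_red e H0) in hH; move: (red e H0) rH hH0 hH => {H0} H rH hHb hH.
case aH: (all (in_star a) H).
  by left; symmetry; apply: vertex_at_star; exists H.
right; have := negbT aH; rewrite -has_predC => /hasP [x xH /= nax].
have hx : in_star b x by apply: (allP hHb).
have [H1 [H2 EH]] : exists H1 H2, H = H1 ++ x :: H2.
  by case/splitPr: xH => H1 H2; exists H1, H2.
have ebx : e b x.1.
  case/orP: hx => // /eqP xb; move: nax.
  by rewrite /in_star /= xb e_sym eba orbT.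
move: nax; rewrite /in_star /= negb_or => /andP [xa eax].
have hw : (conj_gen (1 * pi H1) x.1, x) \in walls (1 : G) H.
  by rewrite EH; exact: mem_walls.
(* The wall of [x] is crossed by [K], [M] or [N] too; only [M] can contain such a letter, as [x] is
   outside the star of [a]. *)
have {hw} := walls_pi e_sym e_irr rH (etrans (esym hH) hE) hw.
rewrite !walls_cat !mem_cat => /or3P [].
- case/walls_split => K1 [K2 [EK _]].
  move: hK; rewrite EK all_cat /= => /and3P[_].
  by rewrite /in_star /= (negbTE xa) (negbTE eax).
- rewrite mul1g => /walls_split [M1 [M2 [EM hw]]].
  move: (hM); rewrite EM all_cat /= => /and3P[hM1 hcx _].
  have ecx : e c x.1.
    by case/orP: hcx => // /eqP xc; rewrite xc eac in eax.
  have [ax|bc] : a = x.1 \/ b = c.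
  + by apply: (@no_square a b x.1 c) => //; rewrite e_sym.
  + by rewrite ax eqxx in xa.
  subst c; set r := (pi H1)^-1 * (pi K * pi M1).
  have hr : star_group x.1 r.
    by move: hw; rewrite mul1g => /(conj_gen_inj e_sym e_irr)[].
  have hf L : all (in_star b) L ->
      star_group b (pi [seq z <- L | star e x.1 z.1]).
    move=> hL; exists [seq z <- L | star e x.1 z.1] => //.
    by apply/allP => z; rewrite mem_filter => /andP[_ /(allP hL)].
  (* Retracting to the star of [x.1] leaves in [K] only letters of type adjacent to [a] and [x.1];
     by the girth assumption their type is [b]. *)
  have rb : star_group b r.
    rewrite -(ret_star_group hr) !(retM e_sym) (retV e_sym) !ret_pi.
    apply: star_groupM.
      apply: star_groupV; apply: hf; move: hHb; rewrite EH all_cat.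
      by case/andP.
    apply: star_groupM; last exact: hf.
    exists [seq z <- K | star e x.1 z.1] => //.
    apply/allP => z; rewrite mem_filter => /andP[xz /(allP hK)] az.
    move: xz az; rewrite /in_star /star /=.
    case: eqP => /= [-> _|_ exz]; first by rewrite (negbTE xa) (negbTE eax).
    case: eqP => /= [za|_ eaz].
      by rewrite e_sym za in exz; rewrite exz in eax.
    have [ax|->] : a = x.1 \/ b = z.1.
    + by apply: (@no_square a b x.1 z.1) => //; rewrite e_sym.
    + by rewrite ax eqxx in xa.
    by rewrite eqxx.
  rewrite -(vertex_at_star (q * pi K) (h := pi M1)); last by exists M1.
  rewrite -(vertex_at_star q (h := pi H1)); last first.
    by exists H1 => //; move: hHb; rewrite EH all_cat; case/andP.
  by rewrite -(vertex_at_star _ rb) /r -!mulgA mulVKg.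
- case/walls_split => N1 [N2 [EN _]].
  move: hN; rewrite EN all_cat /= => /and3P[_].
  by rewrite /in_star /= (negbTE xa) (negbTE eax).
Qed.

(** The types form a closed walk of length 4, so two opposite ones agree. *)
Lemma ext_no_square (x1 x2 x3 x4 : ext_vertex e) :
  adj x1 x2 -> adj x2 x3 -> adj x3 x4 -> adj x4 x1 -> x1 = x3 \/ x2 = x4.
Proof.
have [q1 [c1 ->]] := vertex_at_ex x1; have [q2 [c2 ->]] := vertex_at_ex x2.
have [q3 [c3 ->]] := vertex_at_ex x3; have [q4 [c4 ->]] := vertex_at_ex x4.
move=> h1 h2 h3 h4.
have [hc|hc] := no_square (adj_type h1) (adj_type h2)
  (adj_type h3) (adj_type h4).
  by subst c3; exact: ext_no_square_same_type h1 h2 h3 h4.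
subst c4; have [|] := ext_no_square_same_type h2 h3 h4 h1; first by right.
by left.
Qed.

(** Unless the walk already meets a centre, a middle part of length at least 3 can be replaced by
    the path through [s] and [s']. Length 0 or 2 would give a triangle or a pentagon of types, and
    length 1 a square of the extension graph, which forces [x = s'] or [x' = s]. *)
Lemma detour n1 n2 n3 (p q x x' s s' : ext_vertex e) : adj s s' ->
  x = s \/ adj x s -> x' = s' \/ adj x' s' ->
  walk adj n1 p x -> walk adj n2 x x' -> walk adj n3 x' q ->
  exists m1 m2 y, [/\ (m1 + m2 <= n1 + n2 + n3)%N, y = s \/ y = s',
    walk adj m1 p y & walk adj m2 y q].
Proof.
move=> ss xs xs' w1 w2 w3.
case: xs => [<-|xs].
  exists n1, (n2 + n3)%N, x; rewrite addnA; split=> //; first by left.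
  exact: walk_cat w2 w3.
case: xs' => [<-|xs'].
  by exists (n1 + n2)%N, n3, x'; split=> //; [right|exact: walk_cat w1 w2].
have via : (3 <= n2)%N -> exists m1 m2 y, [/\ (m1 + m2 <= n1 + n2 + n3)%N,
    y = s \/ y = s', walk adj m1 p y & walk adj m2 y q].
  move=> n23; exists (n1 + 1)%N, n3.+2, s; split; last 1 first.
  - by apply: walkS ss _; apply: walkS w3; exact: adj_sym.
  - by lia.
  - by left.
  - exact: walk_cat w1 (walk1 xs).
have [a [c ex]] := vertex_at_ex x; have [a' [c' ex']] := vertex_at_ex x'.
have [b [d es]] := vertex_at_ex s; have [b' [d' es']] := vertex_at_ex s'.
have t1 : e c d by move: xs; rewrite ex es; exact: adj_type.
have t2 : e c' d' by move: xs'; rewrite ex' es'; exact: adj_type.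
have t3 : e d d' by move: ss; rewrite es es'; exact: adj_type.
have t : walk e n2 c c'.
  move: w2; rewrite ex ex' => h.
  by have [w _ /reach_types] := walk_reach e_sym e_irr h.
case: n2 w2 t via => [|[|[|n2]]] w2 t via.
- have cc := walk0_eq t; subst c'.
  by case: (no_triangle t1 t3); rewrite e_sym.
- have [z xz wz] := walkS_ex w2; have zx := walk0_eq wz; subst z.
  have [h|h] := ext_no_square (adj_sym ss) (adj_sym xs) xz xs'.
    exists n1, (1 + n3)%N, x; rewrite addnA; split=> //; first by right.
    exact: walk_cat w2 w3.
  exists (n1 + 1)%N, n3, x'; split=> //; first by left.
  exact: walk_cat w1 w2.
- have [z cz wz] := walkS_ex t; have [z' zz' wz'] := walkS_ex wz.
  have zc := walk0_eq wz'; subst z'.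
  by case: (no_pentagon t1 t3 _ _ _ (f := z) (d := c')); rewrite // e_sym.
- exact: via.
Qed.

End Girth.

(** * Cut sets of geodesics *)

Section Sequences.

Lemma cat_cons_inj (T : Type) (s1 s2 t1 t2 : seq T) x y :
  s1 ++ x :: s2 = t1 ++ y :: t2 ->
  [\/ exists r, t1 = s1 ++ x :: r /\ s2 = r ++ y :: t2,
      x = y | exists r, s1 = t1 ++ y :: r /\ t2 = r ++ x :: s2].
Proof.
elim: s1 t1 => [|a s1 IH] [|b t1] /=.
- by case=> -> _; constructor 2.
- by case=> <- ->; constructor 1; exists t1.
- by case=> <- <-; constructor 3; exists s1.
- case=> <- /IH [[r [-> ->]]|->|[r [-> ->]]].
  + by constructor 1; exists r.
  + by constructor 2.
  + by constructor 3; exists r.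
Qed.

Lemma not_path_split (T : Type) (r : rel T) a s : ~~ path r a s ->
  exists s1 b c s2, a :: s = s1 ++ b :: c :: s2 /\ ~~ r b c.
Proof.
elim: s a => //= b s IH a; rewrite negb_and; case: (boolP (r a b)) => /= rab.
  by move/IH => [s1 [c [d [s2 [-> h]]]]]; exists (a :: s1), c, d, s2.
by move=> _; exists [::], a, b, s.
Qed.

Lemma not_cycle_split (T : Type) (r : rel T) (s : seq T) :
  (forall a, r a a) -> ~~ cycle r s ->
  exists s1 s2 b c s', [/\ s = s1 ++ s2, s2 ++ s1 = b :: c :: s' & ~~ r b c].
Proof.
move=> rr; case: s => // a s h0.
have [s1 [b [c [s2 [E h]]]]] := not_path_split h0.
case/lastP: s2 E => [|s2 z] E.
  have /rcons_inj E1 : rcons (a :: s) a = rcons (rcons s1 b) c.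
    by rewrite rcons_cons E -!cats1 -catA.
  have ac : a = c := congr1 snd E1; move: {E1}(congr1 fst E1) => /= E1.
  subst c; case: s1 E1 {E} => [|d s1] /=.
    by case=> ab; rewrite ab rr in h.
  case=> ad ->; exists (a :: s1), [:: b], b, a, s1; rewrite -cats1.
  by split=> //; rewrite ad.
have /rcons_inj E1 : rcons (a :: s) a = rcons (s1 ++ b :: c :: s2) z.
  by rewrite rcons_cons E rcons_cat.
exists s1, (b :: c :: s2), b, c, (s2 ++ s1); split=> //.
exact: (congr1 fst E1).
Qed.

Lemma cycle_sorted_flatten (T : Type) (r : rel T) (s : seq T) n :
  cycle r s -> sorted r (flatten (nseq n s)).
Proof.
case: s => [|a s] /=; first by elim: n.
rewrite rcons_path => /andP[ps ls].
have h m : path r (last a s) (flatten (nseq m (a :: s))).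
  by elim: m => //= m IH; rewrite ls cat_path ps.
by case: n => //= n; rewrite cat_path ps h.
Qed.

End Sequences.

Section Cut.
Variables (V : finType) (e : rel V).
Hypotheses (e_sym : symmetric e) (e_irr : irreflexive e).
Hypothesis girth6 : forall c, embedded_cycle e c -> (6 <= size c)%N.

Local Open Scope group_scope.

Local Notation letter := (V * bool)%type.
Local Notation word := (word V).
Local Notation pi := (raag_pi e).
Local Notation adj := (@ext_adj V e).
Local Notation vertex_at := (@vertex_at V e).
Local Notation conj_gen := (@conj_gen V e).
Local Notation in_star := (@in_star V e).
Local Notation star_group := (@star_group V e).

Definition noncomm (x y : letter) : bool := ~~ e x.1 y.1.

(** When the walk reads [x] and [y], it stands in the stars of the two walls, whose centres serve as
    [s] and [s'] in [detour]. *)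
Lemma cross_two q (w1 : word) (x : letter) (w2 : word) (y : letter) w3 n c d :
  reach e n c (w1 ++ x :: w2 ++ y :: w3) d ->
  adj (vertex_at (q * pi w1) x.1) (vertex_at (q * pi (w1 ++ x :: w2)) y.1) ->
  exists m1 m2 z, [/\ (m1 + m2 <= n)%N,
    z = vertex_at (q * pi w1) x.1 \/ z = vertex_at (q * pi (w1 ++ x :: w2)) y.1,
    walk adj m1 (vertex_at q c) z &
    walk adj m2 z (vertex_at (q * pi (w1 ++ x :: w2 ++ y :: w3)) d)].
Proof.
move=> /reach_at [n1 [n2 [b [<- h1 hx]]]].
rewrite -cat_cons => /reach_at [n3 [n4 [b' [<- h2 hy h3]]]] ss.
have star_adj p a z : in_star a z ->
    vertex_at p a = vertex_at p z.1 \/ adj (vertex_at p a) (vertex_at p z.1).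
  by case/orP => [/eqP ->|h]; [left|right; exact: adj_vertex_at].
have := detour e_sym e_irr girth6 ss (star_adj _ _ _ hx) (star_adj _ _ _ hy)
  (reach_walk e_sym e_irr h1 q).
have h2' := reach_walk e_sym e_irr h2 (q * pi w1).
have h3' := reach_walk e_sym e_irr h3 (q * pi (w1 ++ x :: w2)).
rewrite -mulgA -pi_cat in h2'; rewrite -mulgA -pi_cat -catA in h3'.
by move=> /(_ _ _ _ h2' h3'); rewrite -addnA.
Qed.

Lemma key_edge q (X : word) (x y : letter) Y n c d :
  reduced e (X ++ x :: y :: Y) -> e x.1 y.1 ->
  walk adj n (vertex_at q c) (vertex_at (q * pi (X ++ x :: y :: Y)) d) ->
  exists m1 m2 z, [/\ (m1 + m2 <= n)%N, z = x.1 \/ z = y.1,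
    walk adj m1 (vertex_at q c) (vertex_at (q * pi X) z) &
    walk adj m2 (vertex_at (q * pi X) z)
      (vertex_at (q * pi (X ++ x :: y :: Y)) d)].
Proof.
move=> r exy h; have [W /mulgI hW hr] := walk_reach e_sym e_irr h.
have wx := walls_pi e_sym e_irr r hW (mem_walls q X x (y :: Y)).
have := mem_walls q (X ++ [:: x]) y Y; rewrite -catA => wy.
have {wy} := walls_pi e_sym e_irr r hW wy.
(* As [x] lies in the star of [y.1], the wall crossed by [y] is also a wall at [q * pi X]. *)
rewrite pi_cat mulgA conj_gen_letter; last exact: adj_in_star.
move=> wy.
have [w1 [w2 [E1 s1]]] := walls_split wx.
have [v1 [v2 [E2 s2]]] := walls_split wy.
rewrite hW.
(* The walk may cross the two walls in either order. *)
case: (cat_cons_inj (etrans (esym E1) E2)) => [[A [EA EB]]|xy|[A [EA EB]]].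
- have := @cross_two q w1 x A y v2 n c d; rewrite -EB -E1 -EA.
  have -> := esym (vertex_at_eq s1); have -> := esym (vertex_at_eq s2).
  move=> /(_ hr (adj_vertex_at e_sym e_irr _ exy))[m1 [m2 [z [hm hz h1 h2]]]].
  exists m1, m2; case: hz h1 h2 => -> h1 h2.
  + by exists x.1; split=> //; left.
  + by exists y.1; split=> //; right.
- by rewrite xy e_irr in exy.
- have := @cross_two q v1 y A x w2 n c d; rewrite -EB -E2 -EA.
  have -> := esym (vertex_at_eq s1); have -> := esym (vertex_at_eq s2).
  have eyx : e y.1 x.1 by rewrite e_sym.
  move=> /(_ hr (adj_vertex_at e_sym e_irr _ eyx))[m1 [m2 [z [hm hz h1 h2]]]].
  exists m1, m2; case: hz h1 h2 => -> h1 h2.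
  + by exists y.1; split=> //; right.
  + by exists x.1; split=> //; left.
Qed.

Lemma reach0 c w d : reach e 0 c w d -> c = d /\ all (in_star c) w.
Proof.
move E: 0%N => n h; elim: h E => {n c w d} // n c x w d hx _ IH hn.
have [cd aw] := IH hn; subst c; split=> //=.
by rewrite hx aw.
Qed.

(** From right to left: a letter in the star of [x.1] that is not adjacent to the type of its right
    neighbour, which is [x.1], has type [x.1] itself. *)
Lemma noncomm_block (w : word) x : sorted noncomm (rcons w x) ->
  all (in_star x.1) w -> all (fun y => y.1 == x.1) w.
Proof.
elim: w => //= y w IH s /andP[hy hw].
have {IH}wx := IH (path_sorted s) hw; rewrite wx andbT.
have : noncomm y x.
  case: w s wx {hw} => /= [|z w]; first by case/andP.
  by rewrite /noncomm => /andP[h _] /andP[/eqP <- _].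
rewrite /noncomm /= => /negbTE h.
by move: hy; rewrite /in_star /= e_sym h orbF.
Qed.

(** Letters read after the last arrival at [v] have type [v], so they can be read at the neighbour
    [b] from which the walk arrived, and the last step is dropped. *)
Lemma reach_back n c w v x : x.1 = v -> sorted noncomm (rcons w x) ->
  (0 < n)%N -> reach e n c w v ->
  exists n' b, [/\ n = n'.+1, e b v & reach e n' c w b].
Proof.
move=> x_v + + h; elim: h x_v => {n c w v} //.
- move=> n c y w d hy _ IH xd s n0.
  have [n' [b [-> eb hb]]] := IH xd (path_sorted s) n0.
  by exists n', b; split=> //; exact: reach_letter.
- move=> [|n] c c' w d ec h IH xd s _; last first.
    have [n' [b [[->] eb hb]]] := IH xd s isT.
    by exists n'.+1, b; split=> //; exact: reach_step ec hb.
  have [cd wc] := reach0 h; subst c'; exists 0%N, c; split=> //.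
  apply: reach_star; rewrite -xd in wc ec.
  apply: sub_all (noncomm_block s wc) => y /eqP yx.
  by rewrite /in_star /= yx ec orbT.
Qed.

(** The word is rigid, so reducing the word read by any walk gives it back letter by letter, and the
    walk reads [x] in the star of [x.1]. If it does so at the centre, [reach_back] yields a
    neighbour on the way. *)
Lemma key_link q (X : word) (x : letter) Y n c d :
  reduced e (X ++ x :: Y) -> sorted noncomm (X ++ x :: Y) -> e x.1 c ->
  walk adj n (vertex_at q c) (vertex_at (q * pi (X ++ x :: Y)) d) ->
  exists m1 m2 z, [/\ (m1 + m2 <= n)%N, e x.1 z,
    walk adj m1 (vertex_at q c) (vertex_at (q * pi X) z) &
    walk adj m2 (vertex_at (q * pi X) z) (vertex_at (q * pi (X ++ x :: Y)) d)].
Proof.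
move=> r s exc h; have [W /mulgI hW hr] := walk_reach e_sym e_irr h.
have hR := teq_rigid e_sym e_irr s (pi_teq e_sym e_irr r hW).
have := reach_red hr; rewrite -hR => /reach_at [n1 [n2 [b [<- h1 hb h2]]]].
have h2' := reach_walk e_sym e_irr h2 (q * pi X); rewrite -mulgA -pi_cat in h2'.
case/orP: hb => [/eqP bx|eb]; last first.
  by exists n1, n2, b; rewrite e_sym; split=> //; exact: reach_walk.
subst b; have sX : sorted noncomm (rcons X x).
  by move: s; rewrite -cat_rcons => /cat_sorted2[].
(* [n1] is positive because [c] is adjacent to [x.1], hence distinct from it. *)
have [|n' [b [-> eb hb]]] := reach_back erefl sX _ h1.
  case: n1 h1 => // /reach0[cx _]; move: exc; rewrite cx.
  by rewrite e_irr.
exists n', n2.+1, b; split; [by lia|by rewrite e_sym|exact: reach_walk|].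
by apply: walkS h2'; exact: adj_vertex_at.
Qed.

End Cut.

(** * Cyclically reduced words and the cut set of an element *)

Section Cyclic.
Variables (V : finType) (e : rel V).
Hypotheses (e_sym : symmetric e) (e_irr : irreflexive e).

Local Open Scope group_scope.

Local Notation word := (word V).
Local Notation G := (raag e).
Local Notation pi := (raag_pi e).
Local Notation adj := (@ext_adj V e).
Local Notation vertex_at := (@vertex_at V e).

Definition wpow n (w : word) : word := flatten (nseq n w).

Lemma pi_wpow n w : pi (wpow n w) = pi w ^+ n.
Proof.
elim: n => [|n IH]; first by rewrite expg0.
by rewrite expgS -IH -pi_cat.
Qed.

Lemma stack_wpow v n w : stack e v (wpow n w) = flatten (nseq n (stack e v w)).
Proof. by elim: n => //= n IH; rewrite stack_cat IH. Qed.

(** A form of being cyclically reduced that is visibly stable under rotation. *)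
Definition conj_minimal (w : word) : Prop :=
  forall t w', pi w = t * pi w' * t^-1 -> (size w <= size w')%N.

Lemma conj_minimal_ex (h : G) :
  exists t w, h = t * pi w * t^-1 /\ conj_minimal w.
Proof.
pose P n := `[< exists t w, h = t * pi w * t^-1 /\ size w = n >].
have exP : exists n, P n.
  have [w hw _] := reduced_word_ex e_sym h; exists (size w); apply/asboolP.
  by exists 1, w; rewrite mul1g invg1 mulg1.
case: (ex_minnP exP) => n /asboolP [t [w [hw wn]]] nmin.
exists t, w; split=> // t' w' hw'; rewrite wn; apply: nmin; apply/asboolP.
by exists (t * t'), w'; rewrite hw hw' invgM !mulgA.
Qed.

Lemma conj_minimal_rot a b : conj_minimal (a ++ b) -> conj_minimal (b ++ a).
Proof.
move=> m t w h; have := m (pi a * t) w; rewrite !size_cat addnC; apply.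
rewrite invgM; have -> : pi a * t * pi w * (t^-1 * (pi a)^-1) =
   pi a * (t * pi w * t^-1) * (pi a)^-1 by rewrite !mulgA.
by rewrite -h !pi_cat !mulgA mulgK.
Qed.

Lemma conj_minimal_reduced w : conj_minimal w -> reduced e w.
Proof.
move=> m; have : red e w = w.
  have /size_subseq_leqif /leqifP := red_subseq e w.
  case: eqP => // _ lt; have := m 1 (red e w).
  by rewrite mul1g invg1 mulg1 pi_red // leqNgt lt => /(_ erefl).
by move=> <-; exact: red_reduced.
Qed.

Lemma stack_head v b w s : stack e v w = Some b :: s ->
  exists w1 w2, [/\ w = w1 ++ (v, b) :: w2, all (fun x => e v x.1) w1 &
    stack e v w2 = s].
Proof.
elim: w => //= x w IH; rewrite stack_cons; case: ifP => evx.
  move/IH => [w1 [w2 [-> h1 h2]]]; exists (x :: w1), w2; split=> //=.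
  by rewrite evx.
rewrite /tag_letter; case: eqP => // x_v [xb <-]; exists [::], w; split=> //.
by rewrite -x_v -xb -surjective_pairing.
Qed.

Lemma stack_last v b w s : stack e v w = rcons s (Some b) ->
  exists w1 w2, w = w1 ++ (v, b) :: w2 /\ all (fun x => e v x.1) w2.
Proof.
elim/last_ind: w s => [|w x IH] s; first by case: s.
rewrite -cats1 stack_cat stack_cons -[stack e v [::]]/[::]; case: ifP => evx.
  rewrite cats0 => /IH [w1 [w2 [-> h]]]; exists w1, (rcons w2 x).
  by rewrite -cats1 -catA cat_cons cats1 all_rcons evx.
rewrite cats1 => h0; have := congr1 snd (rcons_inj h0); rewrite /= /tag_letter.
case: eqP => // x_v [xb]; exists w, [::]; split=> //.
by rewrite -x_v -xb -surjective_pairing.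
Qed.

Lemma commute_block v b w : all (fun x => e v x.1) w ->
  commute (pi [:: (v, b)]) (pi w).
Proof.
elim: w => [_|x w IH /= /andP[hx hw]]; first exact: commute1.
by rewrite (pi_cons e x w); apply: commuteM; [exact: letter_comm|exact: IH].
Qed.

(** If the ends of a stack clashed, the two inverse letters could be moved to the ends of [w], and
    conjugation would remove both. *)
Lemma conj_minimal_cycle w v : conj_minimal w -> cycle compat (stack e v w).
Proof.
move=> m; have := conj_minimal_reduced m v.
case E: (stack e v w) => [|a s] //= ps.
rewrite rcons_path ps /=; case la: (last a s) => [b|//].
case: a E ps la => //= c E ps la; apply/negPn/negP => bc.
have [w1 [w2 [Ew h1 h2]]] := stack_head E.
case/lastP: s la h2 {E ps} => [|s z] /=.
  by case=> cb; rewrite cb eqxx in bc.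
rewrite last_rcons => -> h3; have [w3 [w4 [Ew2 h4]]] := stack_last h3.
have cbE : (v, c) = flip (v, b) by move: bc; case: (b); case: (c).
have := m (pi [:: (v, c)]) (w1 ++ w3 ++ w4); rewrite Ew Ew2.
rewrite !size_cat /= !size_cat /= => hm; suff : False by [].
suff /hm : pi (w1 ++ (v, c) :: w3 ++ (v, b) :: w4) =
  pi [:: (v, c)] * pi (w1 ++ w3 ++ w4) * (pi [:: (v, c)])^-1 by lia.
rewrite !pi_cat (pi_cons e (v, c)) pi_cat (pi_cons e (v, b)).
rewrite (commute_block b h4) cbE pi_flip invgK !mulgA.
by rewrite -pi_flip -cbE (commute_block c h1).
Qed.

Lemma wpow_reduced w n : conj_minimal w -> reduced e (wpow n w).
Proof.
move=> m v; rewrite stack_wpow; apply: cycle_sorted_flatten.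
exact: conj_minimal_cycle.
Qed.

Hypothesis girth6 : forall c, embedded_cycle e c -> (6 <= size c)%N.
Hypothesis e_conn : connected_graph e.

Lemma degree_max v : (#|[set u | e v u]%SET| <= max_degree e)%N.
Proof. exact: leq_bigmax. Qed.

(** The exponent [k.+2] provides a second period of the word, whose first letters give the walls to
    be crossed at the translate by [h]. *)
Definition cut_through (h t : G) (A : {set V}) : Prop :=
  forall c d k n, c \in A -> d \in A ->
    walk adj n (vertex_at t c) (vertex_at (h ^+ k.+2 * t) d) ->
    exists m1 m2 z, [/\ (m1 + m2 <= n)%N, z \in A,
      walk adj m1 (vertex_at t c) (vertex_at (h * t) z) &
      walk adj m2 (vertex_at (h * t) z) (vertex_at (h ^+ k.+2 * t) d)].

Lemma cut_set (h : G) :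
  (forall q c, vertex_at (h * q) c <> vertex_at q c) -> inhabited V ->
  exists (t : G) (A : {set V}),
    [/\ A != finset.set0, (#|A| <= max_degree e)%N & cut_through h t A].
Proof.
move=> nofix [v0].
(* If the star of [v] were all of [V], its star subgroup would be the whole group and [h] would fix
   a vertex. *)
have not_star v : exists u, ~~ star e v u.
  apply/existsP; rewrite -negb_forall; apply/negP => /forallP stv.
  case: (nofix 1 v); rewrite mulg1 -[h]mul1g; apply: vertex_at_star.
  have [w -> _] := reduced_word_ex e_sym h; exists w => //.
  by apply/allP => x _; exact: stv.
have [t [w [hw m]]] := conj_minimal_ex h.
have hpow n : h ^+ n * t = t * pi (wpow n w).
  rewrite pi_wpow; elim: n => [|n IH]; first by rewrite !expg0 mul1g mulg1.
  by rewrite !expgS -mulgA IH hw !mulgA mulgVK.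
(* If no two cyclically consecutive letters have adjacent types, the cut set is the link of the
   first letter. *)
case: (boolP (cycle (noncomm e) w)) => cw.
  case Ew : w => [|x w'].
    by case: (nofix 1 v0); rewrite hw Ew pi_nil !mulg1 mulgV.
  exists t, [set u | e x.1 u]%SET; split; first 1 last.
  - exact: degree_max.
  - move=> c d k n; rewrite !inE => hc hd; rewrite hpow.
    have E2 : wpow k.+2 w = w ++ x :: (w' ++ wpow k w) by rewrite /wpow /= Ew.
    have r := wpow_reduced k.+2 m.
    have s : sorted (noncomm e) (wpow k.+2 w) by exact: cycle_sorted_flatten.
    rewrite E2 in r s *; move=> hn.
    have [m1 [m2 [z [h1 h2 h3 h4]]]] := key_link e_sym e_irr r s hc hn.
    exists m1, m2, z; rewrite inE.
    by have := hpow 1%N; rewrite expg1 /wpow /= cats0 => ->.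
  (* An empty link would leave [x.1] alone in the connected graph, against [not_star]. *)
  - apply/negP => /eqP A0.
    have [u] := not_star x.1; case/orP; case/connectP: (e_conn x.1 u) => p.
    case: p => [_ ->|y p /= /andP[xy _] _]; first by left.
    by have := finset.in_set0 y; rewrite -A0 inE xy.
have ncr a : noncomm e a a by rewrite /noncomm e_irr.
(* A pair of adjacent types is rotated to the front, the conjugator [t] changes accordingly, and the
   two types form the cut set. *)
have [s1 [s2 [x [y [s' [Ew Er xy]]]]]] := not_cycle_split ncr cw.
have {}xy : e x.1 y.1 by apply/negPn.
rewrite Ew in m; have := conj_minimal_rot m; rewrite Er => {}m.
pose w1 := [:: x, y & s'].
have {}hw : h = t * pi s1 * pi w1 * (t * pi s1)^-1.
  by rewrite hw Ew /w1 -Er !pi_cat invgM !mulgA mulgK.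
move: (t * pi s1) hw => {cw hpow Ew Er s1 s2 t} t hw.
have hpow n : h ^+ n * t = t * pi (wpow n w1).
  rewrite pi_wpow; elim: n => [|n IH]; first by rewrite !expg0 mul1g mulg1.
  by rewrite !expgS -mulgA IH {1}hw !mulgA mulgVK.
exists t, [set x.1; y.1]%SET; split.
- by apply/set0Pn; exists x.1; rewrite !inE eqxx.
(* If the maximum degree were at most 1, the edge from [x.1] to [y.1] would be the whole graph,
   against [not_star]. *)
- rewrite cards2 (edge_neq e_irr xy) ltnNge; apply/negP => N1.
  have lk1 v a b : e v a -> e v b -> a = b.
    move=> va vb; apply/eqP/negPn/negP => ab.
    have := leq_trans (degree_max v) N1; rewrite leqNgt => /negP; apply.
    rewrite -[2]/(true.+1) -ab -cards2; apply: subset_leq_card.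
    by apply/fintype.subsetP => z; rewrite !inE => /orP[] /eqP ->.
  have [u /negP] := not_star x.1; apply.
  have cl : fingraph.closed e (mem [:: x.1; y.1]).
    apply: (intro_closed (sym_connect_sym e_sym)) => a b ab; rewrite !inE.
    case/orP => /eqP aE; subst a.
      by rewrite (lk1 _ _ _ ab xy) eqxx orbT.
    have yx : e y.1 x.1 by rewrite e_sym.
    by rewrite (lk1 _ _ _ ab yx) eqxx.
  have := closed_connect cl (e_conn x.1 u); rewrite !inE eqxx /star.
  by move=> /esym /orP[/eqP ->|/eqP ->]; [rewrite /= eqxx|rewrite /= xy orbT].
- move=> c d k n _ _; rewrite hpow.
  have E2 : wpow k.+2 w1 = w1 ++ x :: y :: (s' ++ wpow k w1).
    by rewrite /wpow /=.
  have r := wpow_reduced k.+2 m.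
  rewrite -/w1 E2 in r *; move=> hn.
  have [m1 [m2 [z [h1 h2 h3 h4]]]] := key_edge e_sym e_irr girth6 r xy hn.
  exists m1, m2, z; rewrite !inE.
  have := hpow 1%N; rewrite expg1 /wpow /= cats0 => ->; split=> //.
  by case: h2 => ->; rewrite eqxx ?orbT.
Qed.

End Cyclic.

(** * Chains of minimal mean displacement *)

Lemma not_uniq_split (T : eqType) (s : seq T) : ~~ uniq s ->
  exists s1 b s2 s3, s = s1 ++ b :: s2 ++ b :: s3.
Proof.
elim: s => //= a s IH; rewrite negb_and negbK => /orP[|/IH].
  by case/splitPr => s2 s3; exists [::], a, s2, s3.
by move=> [s1 [b [s2 [s3 ->]]]]; exists (a :: s1), b, s2, s3.
Qed.

Lemma iter_cancel (T : Type) (g h : T -> T) k :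
  cancel g h -> cancel (iter k g) (iter k h).
Proof. by move=> gK; elim: k => // k IH x; rewrite iterSr /= gK. Qed.

Section Distance.
Variables (T : Type) (E : T -> T -> Prop).
Hypothesis E_conn : forall x y, exists n, walk E n x y.

Lemma dist_subproof x y : exists n, `[< walk E n x y >].
Proof. by have [n h] := E_conn x y; exists n; apply/asboolP. Qed.

Definition dist (x y : T) : nat := ex_minn (dist_subproof x y).

Lemma dist_walk x y : walk E (dist x y) x y.
Proof. by rewrite /dist; case: ex_minnP => n /asboolP. Qed.

Lemma dist_le n x y : walk E n x y -> (dist x y <= n)%N.
Proof. by rewrite /dist; case: ex_minnP => m _ h w; exact/h/asboolP. Qed.

Lemma dist_triangle x y z : (dist x z <= dist x y + dist y z)%N.
Proof. by apply: dist_le; exact: walk_cat (dist_walk x y) (dist_walk y z). Qed.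

End Distance.

Section Axis.
Variables (T : Type) (E : T -> T -> Prop).
Hypothesis E_sym : forall x y, E x y -> E y x.
Hypothesis E_conn : forall x y, exists n, walk E n x y.
Variables f f' : T -> T.
Hypotheses (fK : cancel f f') (f'K : cancel f' f).
Hypothesis f_mono : forall x y, E x y <-> E (f x) (f y).
Variables (I : finType) (A : {set I}) (j : I -> T).
Hypothesis A_neq0 : A != finset.set0.
Hypothesis cut : forall c d k n, c \in A -> d \in A ->
  walk E n (j c) (iter k.+2 f (j d)) ->
  exists m1 m2 b, [/\ (m1 + m2 <= n)%N, b \in A,
    walk E m1 (j c) (f (j b)) & walk E m2 (f (j b)) (iter k.+2 f (j d))].
Hypothesis f_free : forall m x, iter m.+1 f x <> x.

Local Notation dist := (dist E_conn).

Lemma dist_sym x y : dist x y = dist y x.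
Proof.
by apply/eqP; rewrite eqn_leq; apply/andP; split; apply: dist_le;
  exact: walk_rev E_sym (dist_walk _ _ _).
Qed.

Lemma dist_f x y : dist (f x) (f y) = dist x y.
Proof.
apply/eqP; rewrite eqn_leq; apply/andP; split; apply: dist_le.
  by apply: walk_map (dist_walk _ _ _) => a b /f_mono.
rewrite -{2}(fK x) -{2}(fK y); apply: walk_map (dist_walk _ _ _) => a b.
by move=> h; apply/f_mono; rewrite !f'K.
Qed.

Lemma dist_iter k x y : dist (iter k f x) (iter k f y) = dist x y.
Proof. by elim: k => //= k IH; rewrite dist_f. Qed.

(** A chain stands for a path through successive translates, with one application of [f] per
    step. *)
Definition weight (c d : I) : nat := dist (j c) (f (j d)).

Fixpoint chain_weight (c : I) (s : seq I) : nat :=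
  if s is d :: s' then weight c d + chain_weight d s' else 0.

Lemma chain_weight_cat c s1 s2 : chain_weight c (s1 ++ s2) =
  (chain_weight c s1 + chain_weight (last c s1) s2)%N.
Proof. by elim: s1 c => //= d s1 IH c; rewrite IH addnA. Qed.

(** Each use of [cut] on a shortest walk splits off a step to the next translate, at no cost in
    length. *)
Lemma chain_ex k c d : c \in A -> d \in A ->
  exists s, [/\ {subset s <= A}, size s = k.+1, last c s = d &
    (chain_weight c s <= dist (j c) (iter k.+1 f (j d)))%N].
Proof.
elim: k c => [|k IH] c cA dA.
  exists [:: d]; split=> //=; first by move=> x; rewrite inE => /eqP ->.
  by rewrite addn0.
have w0 := dist_walk E_conn (j c) (iter k.+2 f (j d)).
have [m1 [m2 [b [hm bA w1 w2]]]] := cut cA dA w0.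
have [s [sA ss sl hs]] := IH b bA dA.
exists (b :: s); split=> //=; last 1 first.
- apply: leq_trans hm; apply: leq_add; first exact: dist_le.
  apply: (leq_trans hs); rewrite -dist_f; exact: dist_le w2.
- by move=> x; rewrite inE => /orP[/eqP -> //|/sA].
- by rewrite ss.
Qed.

Definition closed_chain (c : I) (s : seq I) : Prop :=
  [/\ c \in A, {subset s <= A}, s != [::] & last c s = c].

(* A chain longer than #|A| repeats a vertex, where it splits into two shorter
   closed chains. *)
Lemma closed_chain_mean W M :
  (forall c s, closed_chain c s -> (size s <= #|A|)%N ->
     (W * size s <= chain_weight c s * M)%N) ->
  forall c s, closed_chain c s -> (W * size s <= chain_weight c s * M)%N.
Proof.
move=> short c s; move: {2}(size s) (leqnn (size s)) => n.
elim: n c s => [|n IH] c s sn [cA sA s0 sl].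
  by case: s s0 sn {sA sl}.
case: (leqP (size s) #|A|) => [|As]; first exact: short.
have us : ~~ uniq s.
  apply/negP => us; move: As; rewrite ltnNge -(card_uniqP us) => /negP; apply.
  by apply: subset_leq_card; apply/fintype.subsetP.
have [s1 [b [s2 [s3 Es]]]] := not_uniq_split us.
have bA : b \in A by apply: sA; rewrite Es !(mem_cat, inE) eqxx orbT.
have h1 : closed_chain c (s1 ++ b :: s3).
  split=> //; last 2 first.
  - by case: (s1).
  - by move: sl; rewrite Es !last_cat /= last_cat.
  - move=> x; rewrite mem_cat => hx; apply: sA; rewrite Es !(mem_cat, inE).
    move: hx; rewrite inE => /or3P[->|->|->] //; rewrite ?orbT //.
have h2 : closed_chain b (rcons s2 b).
  split=> //; last 2 first.
  - by case: (s2).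
  - by rewrite last_rcons.
  - move=> x; rewrite mem_rcons inE => hx; apply: sA.
    rewrite Es !(mem_cat, inE).
    by case/orP: hx => ->; rewrite ?orbT.
have := leq_add (IH _ _ _ h1) (IH _ _ _ h2).
rewrite Es -cats1 -mulnDr -mulnDl.
have -> : (size (s1 ++ b :: s3) + size (s2 ++ [:: b]) =
  size (s1 ++ b :: s2 ++ b :: s3))%N by rewrite !size_cat /= !size_cat /=; lia.
have -> : (chain_weight c (s1 ++ b :: s3) + chain_weight b (s2 ++ [:: b]) =
  chain_weight c (s1 ++ b :: s2 ++ b :: s3))%N.
  by rewrite !chain_weight_cat /= !chain_weight_cat /=; lia.
move: sn; rewrite Es !size_cat /= !size_cat /= => sn.
by apply; lia.
Qed.

(** A minimum over the closed chains of length at most [#|A|] is one over all closed chains by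
    [closed_chain_mean]; means are compared by cross-multiplication. *)
Lemma min_mean_chain : exists c s, [/\ closed_chain c s, (size s <= #|A|)%N &
  forall d t, closed_chain d t ->
    (chain_weight c s * size t <= chain_weight d t * size s)%N].
Proof.
(* Multiplying by #|A|! turns the mean weights into natural numbers. *)
pose P n := `[< exists c s, [/\ closed_chain c s, (size s <= #|A|)%N &
  n = (chain_weight c s * ((#|A|)`! %/ size s))%N] >].
have [a aA] := set0Pn _ A_neq0.
have exP : exists n, P n.
  exists (chain_weight a [:: a] * ((#|A|)`! %/ 1))%N; apply/asboolP.
  exists a, [:: a]; split=> //; first by split=> // x; rewrite inE => /eqP ->.
  by rewrite card_gt0.
case: (ex_minnP exP) => _ /asboolP [c [s [hc hs ->]]] hmin.
exists c, s; split=> //; apply: closed_chain_mean => d t ht tA.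
have size_gt0 b u : closed_chain b u -> (0 < size u)%N.
  by case=> _ _; case: u.
have := hmin (chain_weight d t * ((#|A|)`! %/ size t))%N.
move=> /(_ (introT (asboolP _) _)) h.
have {}h := h (ex_intro _ d (ex_intro _ t (And3 ht tA erefl))).
have ds := @dvdn_fact (size s) #|A|; have dt := @dvdn_fact (size t) #|A|.
rewrite (size_gt0 _ _ hc) hs in ds; rewrite (size_gt0 _ _ ht) tA in dt.
move: h (divnK (ds isT)) (divnK (dt isT)) (fact_gt0 #|A|).
set F := factorial _; set x := (F %/ size s)%N; set y := (F %/ size t)%N.
move: F x y (chain_weight c s) (chain_weight d t) (size s) (size t).
move=> F x y wc wd ns nt h hx hy F0.
have xy0 : (0 < x * y)%N.
  by rewrite muln_gt0; case: x y hx hy {h} => [|x] [|y]; lia.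
rewrite -(leq_pmul2r xy0).
have -> : (wc * nt * (x * y) = wc * x * F)%N by rewrite -hy; lia.
have -> : (wd * ns * (x * y) = wd * y * F)%N by rewrite -hx; lia.
by rewrite leq_mul2r h orbT.
Qed.

(** For positive [k], a shortest walk from [j c] to its [k]-th translate yields by [chain_ex] a
    closed chain of length [k] and no greater weight. *)
Lemma mean_le_dist c s k : closed_chain c s ->
  (forall d t, closed_chain d t ->
    (chain_weight c s * size t <= chain_weight d t * size s)%N) ->
  (chain_weight c s * k <= dist (j c) (iter k f (j c)) * size s)%N.
Proof.
move=> [cA _ _ _] hmin; case: k => [|k]; first by rewrite muln0.
have [t [tA ts tl ht]] := chain_ex k cA cA.
rewrite -{1}ts; apply: leq_trans (hmin c t _) _.
  by split=> //; case: (t) ts.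
exact: leq_mul ht (leqnn _).
Qed.

Lemma chain_walk c s :
  walk E (chain_weight c s) (j c) (iter (size s) f (j (last c s))).
Proof.
elim: s c => [|d s IH] c; first exact: walk0.
rewrite /= -iterS iterSr; apply: walk_cat (dist_walk _ _ _) _.
rewrite -iterSr /=; apply: walk_map (IH d) => a b /f_mono //.
Qed.

(** * Unrolling a closed chain to a periodic geodesic *)

Section Periodic.
Variables (m w : nat) (p : nat -> T) (x0 : T).
Hypotheses (m_gt0 : (0 < m)%N) (w_gt0 : (0 < w)%N) (p0 : p 0 = x0).
Hypotheses (pw : p w = iter m f x0)
  (p_step : forall i, (i < w)%N -> E (p i) (p i.+1)).
Hypothesis mean_le : forall k, (w * k <= dist x0 (iter k f x0) * m)%N.

Local Notation F := (iter m f).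
Local Notation F' := (iter m f').

Lemma f_mono_iter k x y : E x y -> E (iter k f x) (iter k f y).
Proof. by move=> h; elim: k => //= k; exact: (proj1 (f_mono _ _)). Qed.

Definition ray (n : nat) : T := iter (n %/ w) F (p (n %% w)).

Lemma ray_mul k : ray (k * w) = iter k F x0.
Proof. by rewrite /ray mulnK // modnMl p0. Qed.

Lemma rayD n k : ray (n + k * w) = iter k F (ray n).
Proof. by rewrite /ray [(n + k * w)%N]addnC divnMDl // modnMDl iterD. Qed.

Lemma iterF k x : iter k F x = iter (k * m) f x.
Proof. by elim: k => //= k ->; rewrite -iterD. Qed.

Lemma ray_step n : E (ray n) (ray n.+1).
Proof.
rewrite {2}/ray; have lt := ltn_pmod n w_gt0.
case: (ltnP (n %% w).+1 w) => h.
  have -> : (n.+1 %/ w = n %/ w)%N.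
    by rewrite {1}(divn_eq n w) -addnS divnMDl // (divn_small h) addn0.
  have -> : (n.+1 %% w = (n %% w).+1)%N.
    by rewrite {1}(divn_eq n w) -addnS modnMDl modn_small.
  by rewrite /ray !iterF; apply: f_mono_iter; exact: p_step.
have hw : (n %% w).+1 = w by apply/eqP; rewrite eqn_leq lt h.
have En : n.+1 = ((n %/ w).+1 * w)%N.
  by rewrite {1}(divn_eq n w) -addnS hw mulSnr.
have hp := p_step lt; rewrite hw pw in hp.
by rewrite -/(ray n.+1) En ray_mul iterSr /ray !iterF; exact: f_mono_iter.
Qed.

Lemma ray_dist_le n d : (dist (ray n) (ray (n + d)) <= d)%N.
Proof.
apply: dist_le; exists (fun i => ray (n + i)); rewrite addn0; split=> // i _.
by rewrite addnS; exact: ray_step.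
Qed.

(** A shortcut on the ray would bring some [iter k F x0] closer to [x0] than [k * w], against
    [mean_le]. *)
Lemma ray_dist n d : dist (ray n) (ray (n + d)) = d.
Proof.
apply/eqP; rewrite eqn_leq ray_dist_le leqNgt; apply/negP => lt.
(* [k] only has to be so large that [k * w] is not less than [n + d]. *)
pose k := (n + d).+1.
have hk : (n + d <= k * w)%N by apply: leq_trans (leqnSn _) _; exact: leq_pmulr.
have h1 := ray_dist_le 0 n; have h2 := ray_dist_le (n + d) (k * w - (n + d)).
rewrite subnKC // in h2; rewrite add0n in h1.
have h3 := dist_triangle E_conn (ray 0) (ray n) (ray (k * w)).
have h4 := dist_triangle E_conn (ray n) (ray (n + d)) (ray (k * w)).
have r0 : ray 0 = x0 := ray_mul 0.
have := mean_le (k * m); rewrite -iterF -ray_mul -r0 leqNgt => /negP; apply.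
rewrite mulnCA mulnA ltn_pmul2r //; lia.
Qed.

(* The shift by [absz i] periods only serves to make the index nonnegative. *)
Definition line (i : int) : T :=
  iter (absz i) F' (ray (absz (i + Posz (absz i * w))%R)).

(** Periods added to the index are undone by [F'], so every shift to a nonnegative index gives the
    same vertex. *)
Lemma lineE (i : int) (k n : nat) :
  (i + Posz (k * w))%R = Posz n -> line i = iter k F' (ray n).
Proof.
move=> ikn; rewrite /line; set l := absz i.
have [n' hn'] : exists n' : nat, (i + Posz (l * w))%R = Posz n'.
  exists (absz (i + Posz (l * w))%R); rewrite gez0_abs //.
  have : (l <= l * w)%N by exact: leq_pmulr.
  rewrite /l; lia.
rewrite hn' absz_nat.
have shift a b r : iter (a + b) F' (ray (r + b * w)) = iter a F' (ray r).
  by rewrite iterD rayD (iter_cancel _ (iter_cancel m fK)).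
rewrite -(shift l k) -(shift k l) addnC; congr (iter _ _ (ray _)); lia.
Qed.

Lemma line_shift i : F (line i) = line (i + Posz w)%R.
Proof.
pose k := (absz i).+1; have hk : (k <= k * w)%N by exact: leq_pmulr.
have [n hn] : exists n : nat, (i + Posz (k * w))%R = Posz n.
  exists (absz (i + Posz (k * w))%R); rewrite gez0_abs // /k; lia.
rewrite (lineE hn) (@lineE (i + Posz w)%R k (n + w)); last by lia.
have -> : ray (n + w) = F (ray n).
  by rewrite -[RHS]/(iter 1 F (ray n)) -rayD mul1n.
by rewrite /k [RHS]iterSr (iter_cancel m fK) iterS (iter_cancel m f'K).
Qed.

Lemma line_dist i i' : dist (line i) (line i') = absz (i - i')%R.
Proof.
pose k := (absz i + absz i')%N; have hk : (k <= k * w)%N by exact: leq_pmulr.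
have [n hn] : exists n : nat, (i + Posz (k * w))%R = Posz n.
  exists (absz (i + Posz (k * w))%R); rewrite gez0_abs // /k; lia.
have [n' hn'] : exists n : nat, (i' + Posz (k * w))%R = Posz n.
  exists (absz (i' + Posz (k * w))%R); rewrite gez0_abs // /k; lia.
rewrite (lineE hn) (lineE hn').
have -> : dist (iter k F' (ray n)) (iter k F' (ray n')) =
    dist (ray n) (ray n').
  by rewrite -(dist_iter (k * m)) -!iterF !(iter_cancel _ (iter_cancel m f'K)).
have -> : (i - i')%R = (Posz n - Posz n')%R by lia.
case: (leqP n n') => nn.
  by rewrite -{1}(subnKC nn) ray_dist; lia.
by rewrite dist_sym -{1}(subnKC (ltnW nn)) ray_dist; lia.
Qed.

End Periodic.

Lemma axis_ex : exists m w (p : int -> T), [/\ (0 < m <= #|A|)%N,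
  (0 < w)%N, forall i, iter m f (p i) = p (i + Posz w)%R &
  forall i i', dist (p i) (p i') = absz (i - i')%R].
Proof.
have [c [s [hc sA hmin]]] := min_mean_chain.
have m_gt0 : (0 < size s)%N by case: hc => _ _; case: (s).
have [p [p0 pw ps]] := chain_walk c s.
have [_ _ _ cl] := hc; rewrite cl in pw.
(* A chain of weight 0 would make a positive power of [f] fix [j c]. *)
have w_gt0 : (0 < chain_weight c s)%N.
  rewrite lt0n; apply/eqP => w0; rewrite w0 p0 in pw.
  by case: (size s) m_gt0 pw => // n _ /esym; exact: f_free.
have mean k := mean_le_dist k hc hmin.
exists (size s), (chain_weight c s), (line (size s) (chain_weight c s) p).
split=> //; first by rewrite m_gt0.
- exact: line_shift.
- exact: line_dist p0 pw ps mean.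
Qed.

End Axis.

(** * The edge metric and path subgraphs *)

Section EdgeDistance.
Variables (T : Type) (E : T -> T -> Prop).
Hypothesis E_conn : forall x y, exists n, walk E n x y.

Lemma edge_distE (R : realType) x y :
  edge_dist E R x y = (((dist E_conn x y)%:R : R)%R)%:E.
Proof.
apply/eqP; rewrite eq_le; apply/andP; split.
  by apply: ereal_inf_lbound; exists (dist E_conn x y) => //; exact: dist_walk.
apply: le_ereal_inf_tmp => _ [n hn <-]; rewrite lee_fin ler_nat.
exact: dist_le.
Qed.

Lemma path_subgraph_map (f : T -> T) (p : int -> T) :
  subgraph_map f (path_subgraph p) = path_subgraph (f \o p).
Proof.
rewrite /subgraph_map /path_subgraph /=; congr Subgraph.
  by rewrite image_comp.
apply/seteqP; split=> [_ [_ [i _ <-] <-]|_ [i _ <-]] /=.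
  by exists i => //; rewrite image_setU !image_set1.
exists [set p i; p (i + 1)%R]%classic; first by exists i.
by rewrite image_setU !image_set1.
Qed.

Lemma path_subgraph_shift (p : int -> T) (w : int) :
  path_subgraph (fun i => p (i + w)%R) = path_subgraph p.
Proof.
congr Subgraph; apply/seteqP; split=> _ [i _ <-].
- by exists (i + w)%R.
- by exists (i - w)%R => //; rewrite subrK.
- by exists (i + w)%R => //; rewrite addrAC.
- by exists (i - w)%R => //=; rewrite (addrAC (i - w)%R) !subrK.
Qed.

Lemma subgraph_map_comp (f h : T -> T) (L : subgraph T) :
  subgraph_map f (subgraph_map h L) = subgraph_map (f \o h) L.
Proof.
case: L => vs es; rewrite /subgraph_map /=; congr Subgraph.
  by rewrite image_comp.
by rewrite image_comp; congr image; apply/funext => s /=; rewrite image_comp.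
Qed.

Lemma subgraph_map_id (L : subgraph T) : subgraph_map id L = L.
Proof.
case: L => vs es; rewrite /subgraph_map /=; congr Subgraph.
  by rewrite image_id.
rewrite -[RHS]image_id; congr image; apply/funext => s /=.
by rewrite image_id.
Qed.

End EdgeDistance.

(** * Loxodromic elements *)

Section Loxodromic.
Variables (R : realType) (V : finType) (e : rel V).
Hypotheses (e_sym : symmetric e) (e_irr : irreflexive e).
Hypothesis e_conn : connected_graph e.

Local Open Scope group_scope.

Local Notation G := (raag e).
Local Notation adj := (@ext_adj V e).
Local Notation vertex_at := (@vertex_at V e).

Lemma reach_ex c w d : exists n, reach e n c w d.
Proof.
have nil_ex a b : exists n, reach e n a [::] b.
  have /connectP [p pp ->] := e_conn a b; exists (size p).
  elim: p a pp => [|z p IH] a /=; first by move=> _; exact: reach_nil.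
  by case/andP => az /IH; exact: reach_step.
elim: w c => [|x w IH] c; first exact: nil_ex.
have [n hn] := nil_ex c x.1; have [m hm] := IH x.1.
exists (n + m)%N; rewrite -[x :: w]cat0s; apply: reach_cat hn _ _ _ _.
by apply: reach_letter hm; rewrite /in_star /= eqxx.
Qed.

Lemma ext_conn (x y : ext_vertex e) : exists n, walk adj n x y.
Proof.
have [q [c ->]] := vertex_at_ex x; have [q' [d ->]] := vertex_at_ex y.
have [w hw _] := reduced_word_ex e_sym (q^-1 * q').
have [n hn] := reach_ex c w d; exists n.
have := reach_walk e_sym e_irr hn q; rewrite -hw mulVKg; exact.
Qed.

Lemma ext_act_vertex_at q c g :
  ext_act (vertex_at q c) g = vertex_at (g^-1 * q) c.
Proof. by apply: val_inj => /=; rewrite /conj_gen invgM invgK conjgM. Qed.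

Lemma ext_actM (x : ext_vertex e) g h :
  ext_act (ext_act x g) h = ext_act x (g * h).
Proof. by apply: val_inj => /=; rewrite conjgM. Qed.

Lemma ext_act1 (x : ext_vertex e) : ext_act x 1 = x.
Proof. by apply: val_inj => /=; rewrite conjg1. Qed.

Lemma ext_actX (x : ext_vertex e) g n :
  ext_act x (g ^+ n) = iter n (@ext_act V e ^~ g) x.
Proof.
elim: n => [|n IH]; first by rewrite expg0 ext_act1.
by rewrite expgSr -ext_actM IH.
Qed.

Lemma ext_actK g : cancel (@ext_act V e ^~ g) (@ext_act V e ^~ g^-1).
Proof. by move=> x; rewrite ext_actM mulgV ext_act1. Qed.

Lemma ext_actVK g : cancel (@ext_act V e ^~ g^-1) (@ext_act V e ^~ g).
Proof. by move=> x; rewrite ext_actM mulVg ext_act1. Qed.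

Lemma ext_act_adj g x y : adj x y -> adj (ext_act x g) (ext_act y g).
Proof.
case=> ne com; split.
  by move=> h; apply: ne; exact: (can_inj (ext_actK g)).
by rewrite /commute /= -!conjMg com.
Qed.

Lemma ext_act_adjE g x y : adj x y <-> adj (ext_act x g) (ext_act y g).
Proof.
split; first exact: ext_act_adj.
by move/(ext_act_adj g^-1); rewrite !ext_actM mulgV !ext_act1.
Qed.

(** If a positive power of [g] fixed [y], its powers would move [x] by at most [d x y + d y x], so
    the displacement rate would become arbitrarily small along the multiples of [m.+1]. *)
Lemma loxodromic_free (g : G) : loxodromic R g ->
  forall m (x : ext_vertex e), iter m.+1 (@ext_act V e ^~ g) x <> x.
Proof.
move=> [x [cv pos]] m y fix_y.
pose f := @ext_act V e ^~ g; pose d := dist ext_conn.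
have d_f k a b : d (iter k f a) (iter k f b) = d a b.
  exact: (dist_iter ext_conn (ext_actK g) (ext_actVK g) (ext_act_adjE g)).
have bound k : (d x (iter (k * m.+1) f x) <= d x y + d y x)%N.
  have fy : iter (k * m.+1) f y = y.
    by elim: k => // k IH; rewrite mulSn iterD IH.
  apply: leq_trans (dist_triangle ext_conn x y _) _.
  by rewrite leq_add2l -[in X in (X <= _)%N]fy -/d d_f.
have [eps eps0 epsl] : exists2 r : R, (0 < r)%R &
    (r%:E < translation_length R g x)%E.
  move: pos; case: (translation_length R g x) => [l|_|//].
    rewrite lte_fin => l0; exists (l / 2)%R; first by rewrite divr_gt0.
    by rewrite lte_fin ltr_pdivrMr // mulr_natr mulr2n ltrDl.
  by exists 1%R; rewrite ?ltr01 // ltry.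
have [N _ hN] := cv _ (open_ereal_gt' epsl).
(* [k] exceeds [N], where the rate is above [eps], and also [C / eps], which makes the rate at most
   [eps]. *)
pose C := (d x y + d y x)%N; pose k := (N + Num.Def.truncn (C%:R / eps)).+1.
have := hN (k * m.+1)%N; rewrite /= => /(_ _).
rewrite /displacement_rate (edge_distE ext_conn) ext_actX -EFinM lte_fin.
rewrite -/f -/d.
have kn : (k <= k * m.+1)%N by exact: leq_pmulr.
have Nk : (N <= k * m.+1)%N by apply: leq_trans kn; rewrite /k; lia.
move=> /(_ Nk); apply/negP; rewrite -leNgt.
rewrite ler_pdivrMr; last by rewrite ltr0n.
apply: (@le_trans _ _ C%:R%R); first by rewrite ler_nat bound.
have Ck : (C%:R / eps < k%:R)%R.
  apply: lt_le_trans (truncnS_gt _) _.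
  by rewrite ler_nat /k ltnS leq_addl.
rewrite ltr_pdivrMr // in Ck; apply: le_trans (ltW Ck) _.
by rewrite mulrC ler_pM2l // ler_nat.
Qed.

End Loxodromic.

Theorem theorem3 (R : realType) (V : finType) (e : rel V)
    (e_sym : symmetric e) (e_irr : irreflexive e)
    (e_conn : connected_graph e)
    (e_girth : (6%:R%:E <= girth e R)%E)
    (g : raag e) (g_lox : loxodromic R g) :
  exists (m : nat) (L : 'I_m -> subgraph (ext_vertex e)),
    [/\ (1 <= m <= max_degree e)%N,
        forall i : 'I_m, bi_infinite_geodesic (@ext_adj V e) R (L i)
      & cyclically_permutes g L].
Proof.
have girth6 c : embedded_cycle e c -> (6 <= size c)%N.
  move=> hc; rewrite -(ler_nat R) -lee_fin; apply: le_trans e_girth _.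
  by apply: ereal_inf_lbound; exists c.
pose f := @ext_act V e ^~ g.
have free := loxodromic_free e_sym e_irr e_conn g_lox.
have iter_xv n q c : iter n f (vertex_at q c) = vertex_at (g^-1 ^+ n * q)%g c.
  elim: n => [|n IH]; first by rewrite expg0 mul1g.
  by rewrite iterS IH /f ext_act_vertex_at mulgA -expgS.
have [t [A [A0 Amax cut]]] : exists (t : raag e) (A : {set V}),
    [/\ A != finset.set0, (#|A| <= max_degree e)%N & cut_through g^-1%g t A].
  apply: cut_set => //.
  - by move=> q c; rewrite -ext_act_vertex_at; exact: (free 0%N).
  - by have [x _] := g_lox; have [_ [c _]] := vertex_at_ex x.
have [|m [w [p [mA w0 pm pd]]]] := axis_ex (@adj_sym V e)
  (ext_conn e_sym e_irr e_conn) (@ext_actK V e g) (@ext_actVK V e g)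
  (ext_act_adjE g) (j := vertex_at t) A0 _ free.
  move=> c d k n cA dA; rewrite iter_xv => h.
  have [m1 [m2 [z [h1 h2 h3 h4]]]] := cut c d k n cA dA h.
  by exists m1, m2, z; rewrite ext_act_vertex_at.
(* The translates of the axis by powers of [g]; by [pm] the [m]-th power only shifts the axis along
   itself. *)
pose L k := path_subgraph (iter k f \o p).
have mapL i k : subgraph_map (iter i f) (L k) = L (i + k)%N.
  rewrite path_subgraph_map; congr path_subgraph; apply/funext => z /=.
  by rewrite iterD.
have mapL_inj i : injective (subgraph_map (iter i f)).
  apply: (@can_inj _ _ _ (subgraph_map (iter i (@ext_act V e ^~ g^-1%g)))) => M.
  rewrite subgraph_map_comp -[RHS]subgraph_map_id; congr subgraph_map.
  by apply/funext => z /=; rewrite (iter_cancel _ (@ext_actK V e g)).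
have Lm : L m = L 0%N.
  rewrite /L -[in RHS](path_subgraph_shift _ (Posz w)); congr path_subgraph.
  by apply/funext => z /=; exact: pm.
(* The translates might repeat before [m]; the least period gives distinct ones and is at most
   [m]. *)
pose P n := (0 < n)%N && `[< L n = L 0%N >].
have Pm : P m by rewrite /P; case/andP: mA => -> _; exact/asboolP.
case: (ex_minnP (ex_intro P m Pm)) => n /andP[n0 /asboolP Ln] nmin.
exists n, (fun i => L i); split.
- rewrite n0; apply: leq_trans Amax; apply: leq_trans (nmin _ Pm) _.
  by case/andP: mA.
- move=> i; exists (iter i f \o p); split=> // a b /=.
  rewrite (edge_distE (ext_conn e_sym e_irr e_conn)).
  rewrite (dist_iter _ (@ext_actK V e g) (@ext_actVK V e g) (ext_act_adjE g)).
  by rewrite pd.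
split=> [i k ik|i]; last first.
  rewrite (mapL 1%N i) add1n /=; case: (ltnP i.+1 n) => h.
    by rewrite modn_small.
  have -> : i.+1 = n by apply/eqP; rewrite eqn_leq ltn_ord.
  by rewrite modnn.
(* Equal translates [L a] and [L b] would give the smaller period [b - a]. *)
have no_repeat (a b : 'I_n) : (a < b)%N -> L a <> L b.
  move=> ab Lab; have : P (b - a)%N.
    rewrite /P subn_gt0 ab; apply/asboolP; apply: (mapL_inj a).
    by rewrite !mapL addn0 subnKC // ltnW.
  by move/nmin; rewrite leqNgt (leq_ltn_trans (leq_subr _ _) (ltn_ord b)).
apply: val_inj; case: (ltngtP i k) => // h.
  by case: (no_repeat _ _ h ik).
by case: (no_repeat _ _ h (esym ik)).
Qed.
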